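(* Let $\beta>0$ be irrational and let $\Lambda\subseteq\mathbb{R}$ be a sequence with lower Beurling density $D^-(\Lambda)>\frac{2}{\beta}$. Then every $f\in V_\beta^1(\varphi)$ is determined up to a global phase by the values $|\mathcal{G}f(x,\omega)|$, $(x,\omega)\in\Lambda\times\mathbb{Z}$; that is, if $f,h\in V_\beta^1(\varphi)$ satisfy $|\mathcal{G}f(x,\omega)|=|\mathcal{G}h(x,\omega)|$ for every $(x,\omega)\in\Lambda\times\mathbb{Z}$, then there exists $\tau\in\mathbb{C}$ with $|\tau|=1$ such that $f=\tau h$. In particular, for every $\varepsilon>0$ and every irrational $\beta>0$, if $f,h\in V_\beta^1(\varphi)$ satisfy $|\mathcal{G}f(z)|=|\mathcal{G}h(z)|$ for every $z\in\frac{\beta}{2+\varepsilon}\mathbb{Z}\times\mathbb{Z}$, then $f=\tau h$ for some $\tau\in\mathbb{C}$ with $|\tau|=1$.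
   Context: Let $\varphi(t)=e^{-\pi t^2}$. The Gabor transform of $f\in L^2(\mathbb{R})$ (complex-valued) is $\mathcal{G}f(x,\omega)=\int_{\mathbb{R}} f(t)\varphi(t-x)e^{-2\pi i t\omega}\,dt$ for $(x,\omega)\in\mathbb{R}^2$. For $\beta>0$, the Gaussian shift-invariant space is $V_\beta^1(\varphi)=\{f\in L^1(\mathbb{R}) : f=\sum_{k\in\mathbb{Z}}c_k\varphi(\cdot-\beta k),\ c=(c_k)_{k}\in\ell^1(\mathbb{Z})\}$, with complex coefficients; its elements are continuous and lie in $L^2(\mathbb{R})$. The lower Beurling density of $\Lambda\subseteq\mathbb{R}$ is $D^-(\Lambda)=\liminf_{r\to\infty}\left(\inf_{a\in\mathbb{R}}\frac{\#(\Lambda\cap[a,a+r))}{r}\right)$. *)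

(* Defs.v *)
From HB Require Import structures.
From mathcomp Require Import all_boot all_order all_algebra.
From mathcomp Require Import complex.
From mathcomp Require Import all_classical all_reals all_analysis.

Set Implicit Arguments.
Unset Strict Implicit.
Unset Printing Implicit Defensive.

Import Order.TTheory GRing.Theory Num.Theory.
Import numFieldNormedType.Exports.

Local Open Scope classical_set_scope.
Local Open Scope complex_scope.
Local Open Scope ring_scope.

Definition gaussian {R : realType} (t : R) : R := expR (- (pi * t ^+ 2)).

Definition expi {R : realType} (y : R) : R[i] := cos y +i* sin y.

Definition cintegrable {R : realType} (f : R -> R[i]) : Prop :=
  (@lebesgue_measure R).-integrable setT (fun t => (complex.Re (f t))%:E) /\
  (@lebesgue_measure R).-integrable setT (fun t => (complex.Im (f t))%:E).

(* The Lebesgue integral of the library is real-valued, so a complex-valued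
   function is integrated through its real and imaginary parts. *)
Definition cintegral {R : realType} (f : R -> R[i]) : R[i] :=
  (\int[@lebesgue_measure R]_(t in setT) complex.Re (f t))
  +i* (\int[@lebesgue_measure R]_(t in setT) complex.Im (f t)).

Definition gabor {R : realType} (f : R -> R[i]) (x w : R) : R[i] :=
  cintegral (fun t => f t * (gaussian (t - x))%:C * expi (- (2 * pi * t * w))).

(* Symmetric partial sums; for the absolutely summable families used below the
   order of summation is irrelevant. *)
Definition is_sumZ {R : realType} (u : int -> R[i]) (s : R[i]) : Prop :=
  (fun n : nat => \sum_(0 <= k < (2 * n).+1) u (k%:Z - n%:Z)) @ \oo --> (s : R[i]^o).

Definition in_l1Z {R : realType} (c : int -> R[i]) : Prop :=
  summable [set: int] (fun k => (Normc.normc (c k))%:E).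

(* Elements of the shift-invariant space are represented by their continuous
   representatives, so the series expansion is required at every point. *)
Definition gaussian_SIS {R : realType} (beta : R) : set (R -> R[i]) :=
  [set f | cintegrable f /\
    exists c : int -> R[i], in_l1Z c /\
      forall t, is_sumZ (fun k => c k * (gaussian (t - beta * k%:~R))%:C) (f t)].

Definition lower_beurling_density {R : realType} (L : set R) : \bar R :=
  limf_einf (fun r : R => ereal_inf
    [set (counting (L `&` `[a, (a + r)%R[%classic) * (r^-1)%:E)%E | a in [set: R]])
    (pinfty_nbhs R).

(* Main.v *)
(* With [u k = c k * conj (c (k - m))], expanding [f] in translates of the Gaussian gives, up to a
   non-vanishing factor, [gabor f x n = sum_k c k * expR (- pi (beta k - x)^2 / 2) * z^(k n)]
   for [z = exp (- i pi beta)].  Since [beta] is irrational, Cesaro means over [n] of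
   [|gabor f x n|^2 z^(- m n)] recover the autocorrelations of the weighted coefficients;
   completing the square, these are the values at [w = exp (2 pi beta (x + beta m / 2))] of
   the Laurent series [sum_k u k * expR (- pi beta^2 k^2) w^k].  Hence the Laurent series of the
   difference of the [u]'s of [f] and [h] vanishes at one positive real point for every point of
   [Lambda].  Dividing out a zero [w] of a Laurent series with coefficients [h k] divides the
   bound [sup_k |h k| rho^k] by [rho / w - 1], for [rho > w]; against the growth [exp (pi T^2)] of
   this bound at [rho = exp (2 pi beta T)], more than [2 / beta] zeros per unit length force the
   series to be zero.  So [c] and [d] have equal autocorrelations, and differ by a phase. *)

Require Import Defs.
From HB Require Import structures.
From mathcomp Require Import all_boot all_order all_algebra.
From mathcomp Require Import complex.
From mathcomp Require Import all_classical all_reals all_analysis.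
From mathcomp Require Import finmap measurable_realfun zify ring lra.

Import Order.TTheory GRing.Theory Num.Theory.
Import numFieldNormedType.Exports.

Local Open Scope classical_set_scope.
Local Open Scope ring_scope.

(** * Dividing a Laurent series by a zero *)

(** The partial sums of [is_sumZ], over any additive monoid so that real and complex series share
    the same lemmas. *)
Definition symsum {V : nmodType} (u : int -> V) (n : nat) : V :=
  \sum_(0 <= k < (2 * n).+1) u (k%:Z - n%:Z).

Lemma symsum0 {V : nmodType} (u : int -> V) : symsum u 0 = u 0.
Proof. by rewrite /symsum big_nat1 subr0. Qed.

Lemma symsumS {V : nmodType} (u : int -> V) n :
  symsum u n.+1 = symsum u n + u n.+1%:Z + u (- n.+1%:Z).
Proof.
rewrite /symsum mulnS addSn add1n big_nat_recl//= big_nat_recr//=.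
rewrite addrC; congr (_ + _ + _); [|by congr u; lia..].
by apply: eq_bigr => i _; congr u; lia.
Qed.

Lemma symsum_opp {V : nmodType} (u : int -> V) n :
  symsum (fun k => u (- k)) n = symsum u n.
Proof.
by elim: n => [|n IH]; rewrite ?symsum0 ?oppr0// !symsumS IH opprK addrAC.
Qed.

Section Laurent.
Context {R : realType}.
Implicit Types (h k : int -> R) (w v rho M : R).

(** A coefficient substitute for the maximum modulus on the circle of radius [rho]: zeros can then
    be counted in the manner of Jensen by manipulating coefficients only. *)
Definition wbounded rho M h := forall m : int, `|h m| * rho ^ m <= M.

(** Equivalently, the Laurent series converges absolutely on the whole punctured plane. *)
Definition laurent_entire h := forall rho, 0 < rho -> exists M, wbounded rho M h.

Definition laurent_zero h w :=
  symsum (fun m => h m * w ^ m) n @[n --> \oo] --> (0 : R).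

Lemma wbounded_ge0 {rho M h} : 0 < rho -> wbounded rho M h -> 0 <= M.
Proof. by move=> r0 /(_ 0); apply: le_trans; rewrite mulr_ge0// exprz_ge0// ltW. Qed.

Lemma wbounded_opp {rho M h} :
  wbounded rho M h -> wbounded rho^-1 M (fun m => h (- m)).
Proof. by move=> H m; have := H (- m); rewrite exprz_inv. Qed.

Lemma laurent_entire_opp {h} :
  laurent_entire h -> laurent_entire (fun m => h (- m)).
Proof.
move=> H rho r0; have [|M HM] := H rho^-1; first by rewrite invr_gt0.
by exists M; rewrite -[rho]invrK; apply: wbounded_opp.
Qed.

Lemma laurent_zero_opp {h w} :
  laurent_zero h w -> laurent_zero (fun m => h (- m)) w^-1.
Proof.
rewrite /laurent_zero => H; under eq_fun do rewrite -symsum_opp.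
rewrite (_ : (fun m => _) = (fun m => h m * w ^ m))//.
by apply/funext => m; rewrite opprK exprz_inv opprK.
Qed.

Lemma geometric_bound (q : R) (n : nat) : 0 <= q -> q < 1 ->
  \sum_(0 <= i < n) q ^+ i <= (1 - q)^-1.
Proof.
move=> q0 q1; have q1' : 0 < 1 - q by rewrite subr_gt0.
rewrite -(ler_pM2l q1') divff ?gt_eqF//.
rewrite big_mkord -opprB mulNr -subrX1 opprB gerBl.
exact: exprn_ge0.
Qed.

Lemma cvg0_norm_le (u v : nat -> R) : (forall n, `|u n| <= v n) ->
  v n @[n --> \oo] --> (0 : R) -> u n @[n --> \oo] --> (0 : R).
Proof.
move=> H v0; apply: norm_cvg0; apply: (@squeeze_cvgr _ _ _ _ (cst 0) v) => //.
  by apply: nearW => n; rewrite H /= normr_ge0.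
exact: cvg_cst.
Qed.

Lemma le_add_cvg0 (u : nat -> R) {a b : R} :
  (forall n, a <= b + `|u n|) -> u n @[n --> \oo] --> (0 : R) -> a <= b.
Proof.
move=> H /cvg_norm; rewrite normr0 => u0.
have c : (fun n => b + `|u n|) @ \oo --> b + 0.
  by apply: cvgD => //; exact: cvg_cst.
by rewrite -[b]addr0; apply: (cvgr_to_ge c); exact: nearW.
Qed.

(** As [S] vanishes at +oo, [S m] is minus the sum of [g] beyond [m], which is dominated by a
    geometric tail starting at [M * q ^ (m + 1)]. *)
Lemma antidiff_up {g S : int -> R} {M q} :
  0 < q -> q < 1 -> (forall m, S m - S (m - 1) = g m) ->
  S n%:Z @[n --> \oo] --> (0 : R) -> (forall m, `|g m| <= M * q ^ m) ->
  forall m, `|S m| <= M * q ^ m * (q / (1 - q)).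
Proof.
move=> q0 q1 dS S0 gM m.
have M0 : 0 <= M by have := gM 0; rewrite expr0z mulr1; apply: le_trans.
have step (n : nat) : `|S m| <=
    `|S (m + n%:Z)| + M * q ^ m * q * \sum_(0 <= i < n) q ^+ i.
  elim: n => [|n IH]; first by rewrite big_nil mulr0 !addr0.
  apply: (le_trans IH); rewrite big_nat_recr//= mulrDr addrA [leRHS]addrAC lerD2r.
  rewrite (_ : S (m + n%:Z) = S (m + n.+1%:Z) - g (m + n.+1%:Z)); last first.
    by rewrite -dS subKr; congr S; lia.
  apply: (le_trans (ler_normB _ _)); rewrite lerD2l.
  apply: (le_trans (gM _)); rewrite expfzDr ?gt_eqF// -exprnP exprS.
  by rewrite !mulrA.
have shift0 : S (m + n%:Z) @[n --> \oo] --> (0 : R).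
  apply/cvgrPdist_lt => e e0; move/cvgrPdist_lt : S0 => /(_ e e0)[N _ HN].
  exists (N + `|m|)%N => // n /= Nn.
  have -> : m + n%:Z = (absz (m + n%:Z))%:Z by lia.
  by apply: HN => /=; lia.
apply: (le_add_cvg0 (fun n => S (m + n%:Z))) => // n.
apply: (le_trans (step n)); rewrite addrC lerD2r -mulrA ler_wpM2l ?mulr_ge0 ?exprz_ge0 ?(ltW q0)//.
by rewrite ler_pM2l// geometric_bound// ltW.
Qed.

Lemma antidiff_down {g S : int -> R} {M q} :
  1 < q -> (forall m, S m - S (m - 1) = g m) ->
  S (- n%:Z) @[n --> \oo] --> (0 : R) -> (forall m, `|g m| <= M * q ^ m) ->
  forall m, `|S m| <= M * q ^ m / (1 - q^-1).
Proof.
move=> q1 dS S0 gM m; have q0 : 0 < q by apply: lt_trans q1.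
have qV0 : 0 < q^-1 by rewrite invr_gt0.
have qV1 : q^-1 < 1 by rewrite invf_lt1.
(* Reflecting [S] makes the difference at [m] equal to [- g (1 - m)]; the shift by one is the extra
   factor [q] in [M * q]. *)
have := @antidiff_up (fun m => - g (1 - m)) (fun m => S (- m)) (M * q) q^-1 qV0 qV1 _ S0.
move=> /(_ _ _ (- m)); rewrite opprK exprz_inv opprK => H.
rewrite (_ : M * q ^ m / _ = M * q * q ^ m * (q^-1 / (1 - q^-1))); last first.
  by rewrite mulrA; congr (_ / _); rewrite mulrAC mulfK ?gt_eqF.
apply: H => k; last first.
  by rewrite normrN (le_trans (gM _))// exprz_inv expfzDr ?gt_eqF// expr1z mulrA.
by rewrite -dS [RHS]opprB; congr (S _ - S _); lia.
Qed.

(** The bound at the larger radius [2 * w] leaves a decay of order 2^-n at [w]. *)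
Lemma laurent_entire_cvg0 {h w} : 0 < w -> laurent_entire h ->
  h n%:Z * w ^ n%:Z @[n --> \oo] --> (0 : R).
Proof.
move=> w0 eh; have [|M HM] := eh (2 * w); first by rewrite mulr_gt0.
apply: (@cvg0_norm_le _ (geometric M 2^-1)) => [n|]; last first.
  by apply: cvg_geometric; rewrite ger0_norm ?invr_ge0// invf_lt1// ltr1n.
rewrite normrM [in X in _ * X]ger0_norm ?exprz_ge0 ?(ltW w0)//.
rewrite /geometric/= exprVn ler_pdivlMr ?exprn_gt0//.
by have := HM n; rewrite expfzMl mulrA mulrAC.
Qed.

Lemma laurent_entire_cvg0N {h w} : 0 < w -> laurent_entire h ->
  h (- n%:Z) * w ^ (- n%:Z) @[n --> \oo] --> (0 : R).
Proof.
move=> w0 /laurent_entire_opp/(@laurent_entire_cvg0 _ w^-1); rewrite invr_gt0 => /(_ w0).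
by under eq_fun do rewrite exprz_inv.
Qed.

(** Normalised to vanish at 0. Since [Negz n] is -(n+1), its sum has n+1 terms. *)
Definition antidiff (g : int -> R) (m : int) : R :=
  match m with
  | Posz n => \sum_(0 <= i < n) g i.+1%:Z
  | Negz n => - \sum_(0 <= i < n.+1) g (- i%:Z)
  end.

Lemma antidiffB g m : antidiff g m - antidiff g (m - 1) = g m.
Proof.
case: m => [[|n]|n].
- by rewrite (_ : 0%N%:Z - 1 = Negz 0)// /antidiff big_nil big_nat1 opprK add0r oppr0.
- rewrite (_ : n.+1%:Z - 1 = n); last by lia.
  by rewrite /= big_nat_recr//= addrAC subrr add0r.
- rewrite (_ : Negz n - 1 = Negz n.+1); last by lia.
  by rewrite /= [in X in _ - - X]big_nat_recr//= opprK addKr; congr g; lia.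
Qed.

Lemma symsum_antidiff g n : symsum g n = antidiff g n - antidiff g (- n.+1%:Z).
Proof.
elim: n => [|n IH]; first by rewrite symsum0 -(antidiffB g 0).
rewrite symsumS IH -(antidiffB g n.+1%:Z) -(antidiffB g (- n.+1%:Z)).
rewrite (_ : n.+1%:Z - 1 = n); last by lia.
rewrite (_ : - n.+1%:Z - 1 = - n.+2%:Z); last by lia.
by lra.
Qed.

(** Normalise an antidifference to vanish at +oo. Its values at [n] and [- n.+1] differ by a
    symmetric partial sum of the series at [w], so the zero at [w] is exactly what makes it vanish
    at -oo too. *)
Lemma exists_antidiff {h w} : 0 < w -> laurent_entire h -> laurent_zero h w ->
  exists S : int -> R, [/\ forall m, S m - S (m - 1) = h m * w ^ m,
    S n%:Z @[n --> \oo] --> (0 : R) & S (- n%:Z) @[n --> \oo] --> (0 : R)].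
Proof.
move=> w0 eh hw; set g := fun m => h m * w ^ m.
have [|M HM] := eh (2 * w); first by rewrite mulr_gt0.
have cA : cvgn (fun n => antidiff g n%:Z).
  apply: (@normed_cvg R R^o); apply: (@series_le_cvg _ _ (geometric (M / 2) 2^-1)).
  - by move=> n /=; exact: normr_ge0.
  - move=> n; have M0 : 0 <= M by apply: (wbounded_ge0 _ HM); rewrite mulr_gt0.
    by apply: geometric_ge0; rewrite ?divr_ge0.
  - move=> n /=; rewrite normrM [in X in _ * X]ger0_norm ?exprz_ge0 ?(ltW w0)//.
    rewrite /geometric/= -mulrA -exprS exprVn ler_pdivlMr ?exprn_gt0//.
    by have := HM n.+1; rewrite expfzMl mulrA mulrAC.
  - by apply: is_cvg_geometric_series; rewrite ger0_norm ?invr_ge0// invf_lt1// ltr1n.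
set L := limn (fun n => antidiff g n%:Z).
exists (fun m => antidiff g m - L); split.
- by move=> m; rewrite -[RHS](antidiffB g m) opprB addrA subrK.
- by rewrite -(subrr L); apply: cvgB => //; exact: cvg_cst.
- rewrite -(cvg_shiftS (fun n => antidiff g (- n%:Z) - L)).
  have c : (fun n => (antidiff g n%:Z - L) - symsum g n) @ \oo --> (L - L) - 0.
    by apply: cvgB => //; apply: cvgB => //; exact: cvg_cst.
  rewrite subrr subr0 in c; apply: cvg_trans c; apply: near_eq_cvg.
  apply: nearW => n; rewrite symsum_antidiff.
  have E (a x l : R) : (a - l) - (a - x) = x - l by ring.
  exact: E.
Qed.

(** Division by 1 - z/w. The coefficients of the quotient are sums of the terms of the zero series
    on one side of an index; for [rho > w] they are estimated from +oo, for [rho < w] from -oo. The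
    other zeros pass to the quotient, so the division can be repeated. *)
Lemma laurent_divide {h w} : 0 < w -> laurent_entire h -> laurent_zero h w ->
  exists k, [/\ laurent_entire k, forall m, h m = k m - k (m - 1) / w,
    forall rho M, w < rho -> wbounded rho M h -> wbounded rho (M / (rho / w - 1)) k,
    forall rho M, 0 < rho < w -> wbounded rho M h -> wbounded rho (M / (1 - rho / w)) k &
    forall v, 0 < v -> v != w -> laurent_zero h v -> laurent_zero k v].
Proof.
move=> w0 eh hw; have [S [dS Sy SNy]] := exists_antidiff w0 eh hw.
have wm m : 0 < w ^ m by exact: exprz_gt0.
pose k m := S m / w ^ m.
have hk m : h m = k m - k (m - 1) / w.
  rewrite /k expfzDr ?gt_eqF// -exprz_inv expr1z invfM invrK.
  rewrite -!mulrA divff ?gt_eqF// mulr1 -mulrBl dS mulfK ?gt_eqF//.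
have wV rho m : (w / rho) ^ m = w ^ m / rho ^ m.
  by rewrite expfzMl exprz_inv invr_expz.
have gM rho M m : 0 < rho -> wbounded rho M h -> `|h m * w ^ m| <= M * (w / rho) ^ m.
  move=> r0 /(_ m) H; rewrite normrM [in X in _ * X]ger0_norm ?(ltW (wm _))//.
  by rewrite wV mulrA mulrAC ler_pM2r// ler_pdivlMr ?exprz_gt0.
have kM rho m : 0 < rho -> `|k m| * rho ^ m = `|S m| / (w / rho) ^ m.
  move=> r0; rewrite normrM normfV [in X in _ / X]ger0_norm ?(ltW (wm _))//.
  by rewrite wV invf_div mulrA mulrAC.
have up rho M : w < rho -> wbounded rho M h -> wbounded rho (M / (rho / w - 1)) k.
  move=> wr hM m; have r0 : 0 < rho by apply: lt_trans wr.
  rewrite kM// ler_pdivrMr ?exprz_gt0 ?divr_gt0// mulrAC.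
  have := antidiff_up (divr_gt0 w0 r0) _ dS Sy (fun m => gM rho M m r0 hM) m.
  rewrite ltr_pdivrMr// mul1r => /(_ wr) /le_trans; apply.
  rewrite ler_wpM2l//.
    by rewrite mulr_ge0 ?(wbounded_ge0 r0 hM)// exprz_ge0// divr_ge0 ?ltW.
  rewrite le_eqVlt; apply/orP; left; apply/eqP; field.
  by apply/and3P; split; lra.
have down rho M : 0 < rho < w -> wbounded rho M h ->
    wbounded rho (M / (1 - rho / w)) k.
  move=> /andP[r0 rw] hM m.
  rewrite kM// ler_pdivrMr ?exprz_gt0 ?divr_gt0// mulrAC.
  have := antidiff_down _ dS SNy (fun m => gM rho M m r0 hM) m.
  by rewrite invf_div; apply; rewrite ltr_pdivlMr// mul1r.
have ek : laurent_entire k.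
  move=> rho r0; have [rw|wr|->] := ltgtP rho w.
  - have [M HM] := eh rho r0; exists (M / (1 - rho / w)); apply: down => //.
    by rewrite r0.
  - have [M HM] := eh rho r0; exists (M / (rho / w - 1)); exact: up.
  (* At [rho = w] neither geometric ratio is away from 1; there w^m is at most (2w)^m + (w/2)^m,
     which interpolates between two radii already treated. *)
  - have r1 : 0 < 2 * w by rewrite mulr_gt0.
    have r2 : 0 < w / 2 by rewrite divr_gt0.
    have [M1 HM1] := eh _ r1; have [M2 HM2] := eh _ r2.
    have := up (2 * w) M1; rewrite ltr_pMl// ltr1n => /(_ isT HM1) U.
    have := down (w / 2) M2; rewrite r2 ltr_pdivrMr// ltr_pMr// ltr1n => /(_ isT HM2) D.
    eexists => m; apply: le_trans (lerD (U m) (D m)).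
    rewrite -mulrDr ler_wpM2l//.
    case: m => m.
      rewrite (le_trans _ (_ : (2 * w) ^ m <= _))//.
        by rewrite -!exprnP lerXn2r ?nnegrE ?(ltW w0) ?(ltW r1)// ler_peMl ?ler1n// ltW.
      by rewrite lerDl exprz_ge0 ?ltW.
    rewrite (le_trans _ (_ : (w / 2) ^ (Negz m) <= _))//; last first.
      by rewrite lerDr exprz_ge0 ?ltW.
    rewrite !NegzE -!exprz_inv -!exprnP lerXn2r ?nnegrE ?invr_ge0 ?ltW//.
    by rewrite ltf_pV2// ltr_pdivrMr// ltr_pMr// ltr1n.
exists k; split => // v v0 vw hv.
have vw0 : 1 - v / w != 0.
  rewrite subr_eq0; apply: contra vw => /eqP/(congr1 ( *%R^~ w)).
  by rewrite /= mul1r mulfVK ?(gt_eqF w0)// => ->.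
pose a m := k m * v ^ m.
have ha m : h m * v ^ m = a m - v / w * a (m - 1).
  have vm : v ^ m = v ^ (m - 1) * v.
    by rewrite -{1}(subrK 1 m) expfzDr ?gt_eqF// expr1z.
  by rewrite hk /a vm; ring.
(* The partial sums telescope to those of the quotient times 1 - v/w, up to two boundary terms that
   tend to 0. *)
have sym n : symsum (fun m => h m * v ^ m) n = (1 - v / w) * symsum a n
    + v / w * a n - v / w * a (- n.+1%:Z).
  elim: n => [|n IH]; first by rewrite !symsum0 ha sub0r; ring.
  rewrite !symsumS IH !ha.
  rewrite (_ : n.+1%:Z - 1 = n); last by lia.
  by rewrite (_ : - n.+1%:Z - 1 = - n.+2%:Z); [ring|lia].
have an := laurent_entire_cvg0 v0 ek.
have aN := laurent_entire_cvg0N v0 ek.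
have c : (fun n => (1 - v / w)^-1 * (symsum (fun m => h m * v ^ m) n
     - v / w * a n + v / w * a (- n.+1%:Z))) @ \oo -->
    (1 - v / w)^-1 * (0 - v / w * 0 + v / w * 0).
  apply: cvgMr; apply: cvgD; last by apply: cvgMr; rewrite (cvg_shiftS (fun n => a (- n%:Z))).
  by apply: cvgB => //; apply: cvgMr.
rewrite !mulr0 subr0 addr0 mulr0 in c.
apply: cvg_trans c; apply: near_eq_cvg; apply: nearW => n.
have E (x y z : R) : x + y - z - y + z = x by ring.
by rewrite sym E mulKf.
Qed.

End Laurent.

(** * Uniqueness for Gaussian Laurent series *)

Section LaurentUniqueness.
Context {R : realType}.
Implicit Types (h k : int -> R) (w v rho M : R).

Lemma wbounded_le {rho M M' h} : M <= M' -> wbounded rho M h -> wbounded rho M' h.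
Proof. by move=> MM H m; apply: le_trans (H m) MM. Qed.

(** For 1 <= w and 2w <= rho, each division gains the factor 2w/rho at radius [rho], because rho/w -
    1 >= rho/(2w), and loses at most 2 at radius [rho^-1]. Multiplying back by 1 - z/w loses at most
    2 at radius 1. *)
Lemma laurent_divide_seq (ws : seq R) (rho : R) {h} : 1 <= rho ->
  (forall w, w \in ws -> 1 <= w /\ 2 * w <= rho) -> uniq ws ->
  laurent_entire h -> (forall w, w \in ws -> laurent_zero h w) ->
  exists k, [/\ laurent_entire k,
    forall M, wbounded rho M h -> wbounded rho (M * \prod_(w <- ws) (2 * w / rho)) k,
    forall M, wbounded rho^-1 M h -> wbounded rho^-1 (M * 2 ^+ size ws) k,
    forall M, wbounded 1 M k -> wbounded 1 (M * 2 ^+ size ws) h &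
    forall v, 0 < v -> v \notin ws -> laurent_zero h v -> laurent_zero k v].
Proof.
move=> rho1; have rho0 : 0 < rho by apply: lt_le_trans rho1.
elim: ws h => [|w ws IH] h wsB wsU eh zh.
  exists h; split=> // M HM; rewrite ?big_nil ?expr0 ?mulr1//.
have [w1 wr] := wsB w (mem_head _ _).
have w0 : 0 < w by apply: lt_le_trans w1.
move: wsU => /= /andP[wNs wsU].
have [g [eg hg upg downg zg]] := laurent_divide w0 eh (zh w (mem_head _ _)).
have [||k [ek k1 k2 k3 k4]] := IH g _ wsU eg.
- by move=> v vs; apply: wsB; rewrite in_cons vs orbT.
- move=> v vs; have vws : v \in w :: ws by rewrite in_cons vs orbT.
  have [v1 _] := wsB v vws; apply: zg; [exact: lt_le_trans v1| |exact: zh].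
  by apply: contra wNs => /eqP <-.
exists k; split=> //.
- move=> M HM; have M0 := wbounded_ge0 rho0 HM.
  rewrite big_cons mulrA; apply: k1; apply: wbounded_le (upg _ _ _ HM); last first.
    by apply: lt_le_trans wr; rewrite ltr_pMl// ltr1n.
  rewrite ler_wpM2l// -[leRHS]invrK lef_pV2 ?posrE.
  + by rewrite invf_div ler_pdivrMr ?mulr_gt0// mulrBl mul1r mulrCA mulfVK ?gt_eqF//; lra.
  + by rewrite subr_gt0 ltr_pdivlMr// mul1r; lra.
  + by rewrite invr_gt0 divr_gt0// mulr_gt0.
- move=> M HM; have rV0 : 0 < rho^-1 by rewrite invr_gt0.
  have M0 := wbounded_ge0 rV0 HM.
  rewrite /= exprS mulrA; apply: k2; apply: wbounded_le (downg _ _ _ HM); last first.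
    rewrite rV0/= (lt_le_trans _ w1)// invf_lt1//; lra.
  rewrite ler_wpM2l// -[leRHS]invrK lef_pV2 ?posrE ?invr_gt0//.
    have : rho^-1 / w <= 2^-1; last lra.
    by rewrite -invfM lef_pV2 ?posrE ?mulr_gt0//; nra.
  by rewrite subr_gt0 -invfM invf_lt1 ?mulr_gt0//; nra.
- move=> M /k3 H m; rewrite exp1rz mulr1 /= hg exprS mulrCA.
  have := H m; have := H (m - 1); rewrite !exp1rz !mulr1 => Hm1 Hm.
  have -> : 2 * (M * 2 ^+ size ws) = M * 2 ^+ size ws + M * 2 ^+ size ws by ring.
  apply: (le_trans (ler_normB _ _)); apply: lerD => //.
  rewrite normrM normfV (ger0_norm (ltW w0)) ler_pdivrMr//.
  by apply: (le_trans Hm1); rewrite ler_peMr//; apply: le_trans Hm1.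
- move=> v v0; rewrite in_cons negb_or => /andP[vw vs] hv.
  by apply: k4 => //; apply: zg.
Qed.

(* Removing the zeros [ws] above 1, then, after reflection, the zeros [vs] below 1,
   makes all coefficients of the quotient small. *)
Lemma laurent_finite_zeros (ws vs : seq R) (rho M eps : R) h : 1 <= rho ->
  (forall w, w \in ws -> 1 <= w /\ 2 * w <= rho) ->
  (forall v, v \in vs -> 1 < v /\ 2 * v <= rho) -> uniq ws -> uniq vs ->
  laurent_entire h -> wbounded rho M h -> wbounded rho^-1 M h ->
  (forall w, w \in ws -> laurent_zero h w) ->
  (forall v, v \in vs -> laurent_zero h v^-1) ->
  \prod_(w <- ws) (2 * w / rho) <= eps -> \prod_(v <- vs) (2 * v / rho) <= eps ->
  forall m, `|h m| <= M * eps * 4 ^+ (size ws + size vs).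
Proof.
move=> rho1 wsB vsB wsU vsU eh HM HM' zw zv epsw epsv.
have rho0 : 0 < rho by apply: lt_le_trans rho1.
have M0 := wbounded_ge0 rho0 HM.
have [k [ek k1 k2 k3 k4]] := laurent_divide_seq ws rho rho1 wsB wsU eh zw.
have vsB' v : v \in vs -> 1 <= v /\ 2 * v <= rho by move=> /vsB[/ltW].
(* The zeros [v^-1] lie strictly below 1, hence outside [ws], and survive the first division;
   reflection then moves them above 1. *)
have vz v : v \in vs -> laurent_zero (fun m => k (- m)) v.
  move=> vvs; have [v1 _] := vsB v vvs; have v0 : 0 < v by apply: lt_trans v1.
  rewrite -[v]invrK; apply: laurent_zero_opp; apply: k4 (zv v vvs); rewrite ?invr_gt0//.
  apply/negP => /wsB[+ _]; rewrite leNgt => /negP; apply.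
  by rewrite invf_lt1.
have [g [eg g1 g2 g3 g4]] :=
  laurent_divide_seq vs rho rho1 vsB' vsU (laurent_entire_opp ek) vz.
have kp := wbounded_opp (k1 _ HM); have km := wbounded_opp (k2 _ HM').
rewrite invrK in km; have {}g1 := g1 _ km; have {}g2 := g2 _ kp.
have e0 : 0 <= eps.
  apply: le_trans epsw; rewrite big_seq; apply: prodr_ge0 => w /wsB[w1 _].
  by rewrite divr_ge0 ?mulr_ge0// ?(ltW rho0)// (le_trans _ w1).
pose a : R := 2 ^+ size ws; pose b : R := 2 ^+ size vs.
have a1 : 1 <= a by rewrite exprn_ege1// ler1n.
have b1 : 1 <= b by rewrite exprn_ege1// ler1n.
have {}g1 : wbounded rho (M * eps * a * b) g.
  apply: wbounded_le g1; rewrite -/a mulrAC [leRHS]mulrAC -[leLHS]mulr1.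
  rewrite -(mulrA M) -!(mulrA M) ler_wpM2l// -!mulrA mulrCA (mulrC a).
  by rewrite !mulrA ler_wpM2r ?(le_trans _ a1)// mulr1 (le_trans epsv)// ler_peMr.
have {}g2 : wbounded rho^-1 (M * eps * a * b) g.
  apply: wbounded_le g2; rewrite -/b ler_wpM2r ?(le_trans _ b1)//.
  by rewrite -mulrA ler_wpM2l// (le_trans epsw)// ler_peMr.
(* Non-negative indices use the bound at [rho], negative ones the bound at [rho^-1]. A gain [eps] is
   therefore required at both radii: [ws] supplies one and [vs] the other. *)
have g01 : wbounded 1 (M * eps * a * b) g.
  move=> m; rewrite exp1rz mulr1; case: m => m.
  - by apply: le_trans (g1 m); rewrite ler_peMr// exprn_ege1.
  - apply: le_trans (g2 (Negz m)); rewrite ler_peMr// NegzE exprz_inv opprK.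
    exact: exprn_ege1.
have k01 := wbounded_opp (g3 _ g01); rewrite invr1 in k01.
have {}k01 : wbounded 1 (M * eps * a * b * b) k.
  by move=> m; have := k01 m; rewrite opprK.
move=> m; have := k3 _ k01 m; rewrite exp1rz mulr1 => /le_trans; apply.
rewrite exprD (_ : 4 = 2 * 2); last by ring.
by rewrite !exprMn -/a -/b le_eqVlt; apply/orP; left; apply/eqP; ring.
Qed.

(** Pools [n] points from each of the first [J] blocks. The sum of the points, the logarithm of the
    product of the zeros up to scaling, is at most n r (1 + ... + J). *)
Lemma block_points (L : set R) (B : nat -> R -> Prop) (r : R) (n : nat) :
  (forall i j x, B i x -> B j x -> i = j) ->
  (forall j x, B j x -> 0 <= x <= j.+1%:R * r) ->
  (forall j, exists s : seq R, [/\ size s = n, uniq s & forall x, x \in s -> L x /\ B j x]) ->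
  forall J, exists s : seq R, [/\ size s = (n * J)%N, uniq s,
    forall x, x \in s -> L x /\ exists2 j, (j < J)%N & B j x &
    \sum_(x <- s) x <= n%:R * r * (J * J.+1)%:R / 2].
Proof.
move=> Binj Bbd Bs; elim=> [|J [s [ss us Ls sums]]].
  by exists [::]; split => //; rewrite ?muln0// big_nil mul0n mulr0 mul0r.
have [t [st ut Lt]] := Bs J; exists (t ++ s); split.
- by rewrite size_cat ss st mulnS.
- rewrite cat_uniq ut us andbT /=; apply/hasPn => x /Ls[_ [j jJ Bj]].
  by apply/negP => /Lt[_ /(Binj _ _ _ Bj)] E; rewrite E ltnn in jJ.
- move=> x; rewrite mem_cat => /orP[/Lt[Lx Bx]|/Ls[Lx [j jJ Bx]]]; split => //.
    by exists J.
  by exists j => //; rewrite ltnS ltnW.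
- rewrite big_cat/=; have : \sum_(x <- t) x <= n%:R * (J.+1%:R * r).
    rewrite -st -sum1_size natr_sum mulr_suml !big_seq; apply: ler_sum => x xt.
    by rewrite mul1r; have [_ /Bbd/andP[]] := Lt _ xt.
  move=> /lerD /(_ sums) /le_trans; apply.
  rewrite le_eqVlt; apply/orP; left; apply/eqP.
  rewrite !natrM -[J.+2%:R]natr1 -[J.+1%:R]natr1; by field.
Qed.

Lemma expR_exprz (x : R) (m : int) : expR x ^ m = expR (x * m%:~R).
Proof.
case: m => m; first by rewrite -exprnP -pmulrn expRM_natr.
by rewrite NegzE -exprz_inv -expRN -exprnP mulrNz mulrN -mulNr -pmulrn expRM_natr.
Qed.

Lemma expR1_ge2 : 2 <= expR 1 :> R.
Proof. by apply: le_trans (expR_ge1Dx _); lra. Qed.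

(** The exponents differ by the square pi (T - beta m)^2. *)
Lemma gaussian_wbounded (A beta T : R) (a : int -> R) :
  (forall m, `|a m| <= A) ->
  wbounded (expR (2 * pi * beta * T)) (A * expR (pi * T ^+ 2))
    (fun m => a m * expR (- (pi * (beta * m%:~R) ^+ 2))).
Proof.
move=> aA m; have A0 := le_trans (normr_ge0 _) (aA m).
rewrite normrM (ger0_norm (expR_ge0 _)) expR_exprz -[leLHS]mulrA -expRD.
rewrite ler_pM ?expR_ge0// ler_expR -subr_ge0.
rewrite (_ : _ - _ = pi * (T - beta * m%:~R) ^+ 2); last by ring.
by rewrite mulr_ge0 ?pi_ge0 ?sqr_ge0.
Qed.

(** The factor 2 is absorbed by 2 <= e. The exponents then add up to nJ + c (sum of the points) -
    nJcT, where the last term is twice the bound on the middle one. *)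
Lemma block_prod (c T : R) (n J : nat) (r : R) (s : seq R) :
  0 <= c -> size s = (n * J)%N -> T = J.+1%:R * r ->
  \sum_(x <- s) x <= n%:R * r * (J * J.+1)%:R / 2 ->
  \prod_(w <- map (fun x => expR (c * x)) s) (2 * w / expR (c * T)) <=
    expR ((n * J)%:R - c * n%:R * r * (J * J.+1)%:R / 2).
Proof.
move=> c0 ss -> sums; rewrite big_map.
apply: (@le_trans _ _ (\prod_(x <- s) expR (1 + c * x - c * (J.+1%:R * r)))).
  apply: ler_prod => x _; rewrite divr_ge0 ?mulr_ge0 ?expR_ge0//=.
  by rewrite expRB expRD ler_wpM2r ?invr_ge0 ?expR_ge0// ler_wpM2r ?expR_ge0// expR1_ge2.
rewrite -expR_sum ler_expR sumrB big_split/= -mulr_sumr !big_const_seq count_predT.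
rewrite !iter_addr_0 ss -mulr_natr -addrA lerD2l -[X in _ - X]mulr_natl.
apply: (@le_trans _ _ (c * (n%:R * r * (J * J.+1)%:R / 2) - (n * J)%:R * (c * (J.+1%:R * r)))).
  by rewrite mul1r lerD2r ler_wpM2l.
by rewrite le_eqVlt; apply/orP; left; apply/eqP; rewrite !natrM; field.
Qed.

End LaurentUniqueness.

(** * Zero counting against Gaussian growth *)

Section GaussianLaurent.
Context {R : realType}.
Implicit Types (h k : int -> R).

Lemma le0_of_expR_bound (x C : R) (N : nat) :
  (forall J : nat, (N <= J)%N -> x * expR J%:R <= C) -> x <= 0.
Proof.
move=> H; rewrite leNgt; apply/negP => x0.
have [J [NJ CJ]] : exists J : nat, (N <= J)%N /\ C / x < J%:R.
  exists (maxn N (Num.truncn (C / x)).+1); rewrite leq_maxl; split => //.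
  by apply: lt_le_trans (truncnS_gt _) _; rewrite ler_nat leq_maxr.
have := H J NJ; rewrite leNgt => /negP; apply.
rewrite ltr_pdivrMr// mulrC in CJ; apply: lt_le_trans CJ _.
by rewrite ler_pM2l// (le_trans _ (expR_ge1Dx _))// lerDr.
Qed.

(** With q = pi r^2, dividing out nJ zeros on each side bounds a coefficient by [A] times the
    exponential of three terms: the growth q (J+1)^2 at T = (J+1) r, the gain from the zeros, at
    most - 2q J (J+1), and constants 5nJ. The total tends to -oo with [J]. *)
Lemma gaussian_laurent_unique (beta r A : R) (n : nat) (L : set R) (a : int -> R) :
  0 < beta -> 1 <= 2 * pi * beta * r -> 2 * r <= beta * n%:R ->
  (forall x : R, exists s : seq R,
     [/\ size s = n, uniq s & forall y, y \in s -> L y /\ x <= y < x + r]) ->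
  (forall m, `|a m| <= A) ->
  (forall x, L x -> laurent_zero (fun m => a m * expR (- (pi * (beta * m%:~R) ^+ 2)))
     (expR (2 * pi * beta * x))) ->
  forall m, a m = 0.
Proof.
move=> b0 cr1 rn Ls aA az m; set h := fun m => _ in az.
set c := 2 * pi * beta in cr1 az.
have pi0 : 0 < pi :> R := pi_gt0 R.
have c0 : 0 < c by rewrite !mulr_gt0.
have r0 : 0 < r by have := lt_le_trans ltr01 cr1; rewrite pmulr_rgt0.
have A0 := le_trans (normr_ge0 _) (aA 0).
have hb T : wbounded (expR (c * T)) (A * expR (pi * T ^+ 2)) h by exact: gaussian_wbounded.
have eh : laurent_entire h.
  move=> rho rho0; have [u <-] := expR_total rho0.
  exists (A * expR (pi * (u / c) ^+ 2)).
  by have := hb (u / c); rewrite mulrC mulfVK// gt_eqF.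
pose Bp (j : nat) (x : R) := j%:R * r <= x < j.+1%:R * r.
(* Open on the left: this is the reflection of a half-open window, and it keeps the points positive,
   so that 0 is counted on one side only. *)
pose Bm (j : nat) (x : R) := j%:R * r < x <= j.+1%:R * r.
have BpU i j x : Bp i x -> Bp j x -> i = j.
  move=> /andP[i1 i2] /andP[j1 j2].
  have := le_lt_trans i1 j2; have := le_lt_trans j1 i2.
  by rewrite !ltr_pM2r// !ltr_nat; lia.
have BmU i j x : Bm i x -> Bm j x -> i = j.
  move=> /andP[i1 i2] /andP[j1 j2].
  have := lt_le_trans i1 j2; have := lt_le_trans j1 i2.
  by rewrite !ltr_pM2r// !ltr_nat; lia.
have Bpb j x : Bp j x -> 0 <= x <= j.+1%:R * r.
  by move=> /andP[j1 /ltW ->]; rewrite andbT (le_trans _ j1)// mulr_ge0// ltW.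
have Bmb j x : Bm j x -> 0 <= x <= j.+1%:R * r.
  by move=> /andP[/ltW j1 ->]; rewrite andbT (le_trans _ j1)// mulr_ge0// ltW.
have Bps j : exists s : seq R, [/\ size s = n, uniq s & forall x, x \in s -> L x /\ Bp j x].
  have [s [ss us Hs]] := Ls (j%:R * r); exists s; split => // x /Hs[Lx H].
  by split => //; rewrite /Bp -natr1 mulrDl mul1r.
have Bms j : exists s : seq R,
    [/\ size s = n, uniq s & forall x, x \in s -> L (- x) /\ Bm j x].
  have [s [ss us Hs]] := Ls (- (j.+1%:R * r)); exists (map -%R s); split.
  - by rewrite size_map.
  - by rewrite map_inj_uniq//; exact: oppr_inj.
  - move=> x /mapP[y /Hs[Ly /andP[y1 y2]] ->]; rewrite opprK; split => //.
    by move: y1 y2; rewrite /Bm -natr1 mulrDl mul1r => y1 y2; apply/andP; split; lra.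
suff : `|h m| <= 0.
  by rewrite normr_le0 mulf_eq0 expR_eq0 orbF => /eqP.
have [s Hs] := choice (block_points L Bp r n BpU Bpb Bps).
have [t Ht] := choice (block_points (fun x => L (- x)) Bm r n BmU Bmb Bms).
have key (J : nat) : `|h m| <= A * expR (pi * (J.+1%:R * r) ^+ 2) *
    expR ((n * J)%:R - c * n%:R * r * (J * J.+1)%:R / 2) * 4 ^+ (n * J + n * J).
  have [ss us Ls' sums] := Hs J; have [st ut Lt' sumt] := Ht J.
  set T := J.+1%:R * r.
  have ex_inj : injective (fun x => expR (c * x)).
    by move=> x y /expR_inj /mulfI; apply; rewrite gt_eqF.
  (* The radius lies one block beyond the last point; as 1 <= c r, this block leaves room for the
     factor 2. *)
  have wR x : x <= J%:R * r -> 2 * expR (c * x) <= expR (c * T).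
    move=> xJ; apply: (@le_trans _ _ (expR (1 + c * x))).
      by rewrite expRD ler_wpM2r ?expR_ge0// expR1_ge2.
    rewrite ler_expR /T -natr1 mulrDl mul1r mulrDr addrC lerD//.
    by rewrite ler_pM2l.
  have := laurent_finite_zeros [seq expR (c * x) | x <- s J] [seq expR (c * x) | x <- t J]
    (expR (c * T)) (A * expR (pi * T ^+ 2))
    (expR ((n * J)%:R - c * n%:R * r * (J * J.+1)%:R / 2)) h.
  rewrite !size_map ss st; apply.
  - rewrite -expR0 ler_expR mulr_ge0 ?(ltW c0)// mulr_ge0// ltW//.
  - move=> _ /mapP[x /Ls'[_ [j jJ Bj]] ->].
    have /andP[x0 xj] := Bpb _ _ Bj.
    split; first by rewrite -expR0 ler_expR mulr_ge0 ?(ltW c0).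
    by apply/wR/(le_trans xj); rewrite ler_pM2r// ler_nat.
  - move=> _ /mapP[x /Lt'[_ [j jJ Bj]] ->].
    have /andP[x0 xj] := Bj; have {}x0 : 0 < x.
      by apply: le_lt_trans x0; rewrite mulr_ge0// ltW.
    split; first by rewrite -expR0 ltr_expR mulr_gt0.
    by apply/wR/(le_trans xj); rewrite ler_pM2r// ler_nat.
  - by rewrite map_inj_uniq.
  - by rewrite map_inj_uniq.
  - exact: eh.
  - exact: hb.
  - by have := hb (- T); rewrite mulrN expRN sqrrN.
  - by move=> _ /mapP[x /Ls'[Lx _] ->]; exact: az.
  - by move=> _ /mapP[x /Lt'[Lx _] ->]; rewrite -expRN -mulrN; exact: az.
  - exact: (block_prod c T n J r _ (ltW c0) ss).
  - exact: (block_prod c T n J r _ (ltW c0) st).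
pose q := pi * r ^+ 2; have q0 : 0 < q by rewrite mulr_gt0 ?exprn_gt0.
(* From [N] on, J q >= 5n + 1. Of the 5n, one n comes from the factors 2 in the product and four
   from 4^(2nJ) <= e^(4nJ); the remaining 1 yields the decay e^(-J). *)
pose N := (Num.truncn ((5 * n%:R + 1) / q)).+1.
apply: (@le0_of_expR_bound _ (A * expR q) N) => J NJ.
rewrite -ler_pdivlMr ?expR_gt0// -expRN.
apply: (le_trans (key J)).
apply: (@le_trans _ _ (A * (expR (pi * (J.+1%:R * r) ^+ 2) *
   (expR ((n * J)%:R - c * n%:R * r * (J * J.+1)%:R / 2) * expR (2 * (n * J + n * J)%:R))))).
  rewrite -2![leLHS]mulrA ler_wpM2l// ler_wpM2l ?expR_ge0// ler_wpM2l ?expR_ge0// expRM_natr.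
  rewrite lerXn2r ?nnegrE ?expR_ge0//.
  rewrite (_ : 4 = 2 * 2); last by ring.
  by rewrite (_ : 2 = 1 + 1 :> R) // expRD ler_pM// expR1_ge2.
rewrite -[leRHS]mulrA ler_wpM2l// -!expRD ler_expR !natrD !natrM -natr1.
have JN : (5 * n%:R + 1) <= J%:R * q.
  rewrite -ler_pdivrMr//; apply: le_trans (ltW (truncnS_gt _)) _.
  by rewrite ler_nat.
(* The density of the zeros enters here, through 2r <= beta n. *)
have cn : c * n%:R * r >= 4 * q.
  by rewrite /c /q; have := ler_wpM2l (ltW (mulr_gt0 pi0 r0)) rn; nra.
have J0 : 0 <= J%:R :> R by [].
have := ler_wpM2l J0 JN.
have JJ0 : 0 <= J%:R * (J%:R + 1) :> R by rewrite mulr_ge0// addr_ge0.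
have := ler_wpM2r JJ0 cn.
rewrite (_ : pi * _ ^+ 2 = q * (J%:R + 1) ^+ 2); last by rewrite /q; ring.
by lra.
Qed.

End GaussianLaurent.

(** * Complex sequences and Cesaro means *)

Section Normc.
Context {R : realType}.
Implicit Types (x y z : R[i]) (u v : nat -> R[i]).
Import Normc.
Local Open Scope complex_scope.

Lemma normc_norm x : (normc x)%:C = `|x|. Proof. by []. Qed.

Lemma normc_ge0 x : 0 <= normc x.
Proof. by rewrite -ler0c normc_norm. Qed.

Lemma normcD x y : normc (x + y) <= normc x + normc y.
Proof. by rewrite -lecR rmorphD /= !normc_norm ler_normD. Qed.

Lemma normcN x : normc (- x) = normc x.
Proof. by apply: complexI; rewrite !normc_norm normrN. Qed.

Lemma normcB x y : normc (x - y) <= normc x + normc y.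
Proof. by rewrite -(normcN y) normcD. Qed.

Lemma normc_dist x y : normc (x - y) = normc (y - x).
Proof. by rewrite -normcN opprB. Qed.

Lemma normc_conj x : normc (conjc x) = normc x.
Proof. by case: x => a b /=; rewrite sqrrN. Qed.

Lemma mul_conjc x : x * conjc x = (normc x ^+ 2)%:C.
Proof.
case: x => a b; apply/eqP; rewrite eq_complex /= sqr_sqrtr ?addr_ge0 ?sqr_ge0//.
by rewrite !expr2; apply/andP; split; apply/eqP; ring.
Qed.

Lemma normc_real (a : R) : normc a%:C = `|a|.
Proof. by rewrite /= expr0n addr0 sqrtr_sqr. Qed.

Lemma normcX x n : normc (x ^+ n) = normc x ^+ n.
Proof. by elim: n => [|n IH]; rewrite ?expr0 ?normc1// !exprS normcM IH. Qed.

Lemma normc_eq0 x : (normc x == 0) = (x == 0).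
Proof. by apply/eqP/eqP => [/eq0_normc//|->]; rewrite normc0. Qed.

Lemma normc_sum (I : Type) (r : seq I) (F : I -> R[i]) :
  normc (\sum_(i <- r) F i) <= \sum_(i <- r) normc (F i).
Proof.
elim: r => [|i r IH]; first by rewrite !big_nil normc0.
by rewrite !big_cons (le_trans (normcD _ _))// lerD2l.
Qed.

Lemma normc_Re x : `|complex.Re x| <= normc x.
Proof. by case: x => a b /=; rewrite -sqrtr_sqr ler_sqrt ?addr_ge0 ?sqr_ge0// lerDl sqr_ge0. Qed.

Lemma normc_Im x : `|complex.Im x| <= normc x.
Proof. by case: x => a b /=; rewrite -sqrtr_sqr ler_sqrt ?addr_ge0 ?sqr_ge0// lerDr sqr_ge0. Qed.

Lemma normc_ReIm x : normc x <= `|complex.Re x| + `|complex.Im x|.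
Proof.
rewrite [x in normc x]complexE (le_trans (normcD _ _))// normcM !normc_real.
by rewrite /= expr0n expr1n add0r sqrtr1 mul1r.
Qed.

(** Complex convergence stated through the real-valued modulus, so that real limit lemmas apply
    directly. *)
Definition ccvg u z := (fun n => normc (u n - z)) @ \oo --> (0 : R).

Lemma cvgC_ccvg u z : (u @ \oo --> (z : R[i]^o)) -> ccvg u z.
Proof.
move=> uz; apply/cvgrPdist_lt => e e0.
have e0' : 0 < e%:C by rewrite ltcR.
have /(@cvgrPdist_lt R[i] R[i]^o)/(_ _ e0') := uz.
apply: filterS => n; rewrite -normc_norm ltcR sub0r normrN ger0_norm ?normc_ge0//.
by rewrite normc_dist.
Qed.

Lemma ccvg_le {u z} (e : nat -> R) : (forall n, normc (u n - z) <= e n) ->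
  e n @[n --> \oo] --> (0 : R) -> ccvg u z.
Proof.
move=> H e0; apply: (cvg0_norm_le _ e) => // n.
by rewrite ger0_norm ?normc_ge0.
Qed.

Lemma ccvg_cst z : ccvg (fun=> z) z.
Proof.
by apply: (ccvg_le (fun=> 0)) => [n|]; [rewrite subrr normc0|exact: cvg_cst].
Qed.

Lemma ccvgD {u v x y} : ccvg u x -> ccvg v y -> ccvg (fun n => u n + v n) (x + y).
Proof.
move=> ux vy; apply: (ccvg_le (fun n => normc (u n - x) + normc (v n - y))) => [n|].
  by rewrite opprD addrACA normcD.
by rewrite -[0]addr0; apply: cvgD.
Qed.

Lemma ccvgMl {u x} y : ccvg u x -> ccvg (fun n => y * u n) (y * x).
Proof.
move=> ux; apply: (ccvg_le (fun n => normc y * normc (u n - x))) => [n|].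
  by rewrite -mulrBr normcM.
by rewrite -[0](mulr0 (normc y)); apply: cvgMr.
Qed.

Lemma ccvg_conj {u x} : ccvg u x -> ccvg (fun n => conjc (u n)) (conjc x).
Proof.
by move=> ux; apply: ccvg_le ux => n; rewrite -rmorphB normc_conj.
Qed.

Lemma ccvgN {u x} : ccvg u x -> ccvg (fun n => - u n) (- x).
Proof. by move=> ux; apply: ccvg_le ux => n; rewrite -opprD normcN. Qed.

Lemma ccvg_ext {u v x} : u =1 v -> ccvg u x -> ccvg v x.
Proof. by move=> /funext ->. Qed.

Lemma ccvg_normc_le {u x} (C : R) :
  ccvg u x -> (forall n, normc (u n) <= C) -> normc x <= C.
Proof.
move=> ux uC; apply: (le_add_cvg0 (fun n => normc (u n - x))) => // n.
rewrite (ger0_norm (normc_ge0 _)) normc_dist.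
by rewrite -[x in leLHS](subrK (u n)) addrC (le_trans (normcD _ _))// lerD2r.
Qed.

Lemma ccvg_unique {u x y} : ccvg u x -> ccvg u y -> x = y.
Proof.
move=> ux uy; apply/eqP; rewrite -subr_eq0 -normc_eq0 eq_le normc_ge0 andbT.
have /ccvg_normc_le := ccvgD ux (ccvgN uy); apply => n.
by rewrite subrr normc0.
Qed.

Lemma ccvg_Re {u x} : ccvg u x -> complex.Re (u n) @[n --> \oo] --> complex.Re x.
Proof.
move=> ux; apply/subr_cvg0; apply: (cvg0_norm_le _ _ _ ux) => n.
apply: le_trans (normc_Re _); by case: (u n) => ? ?; case: x {ux}.
Qed.

Lemma ccvg_Im {u x} : ccvg u x -> complex.Im (u n) @[n --> \oo] --> complex.Im x.
Proof.
move=> ux; apply/subr_cvg0; apply: (cvg0_norm_le _ _ _ ux) => n.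
apply: le_trans (normc_Im _); by case: (u n) => ? ?; case: x {ux}.
Qed.

Lemma ccvg_ReIm {u x} : complex.Re (u n) @[n --> \oo] --> complex.Re x ->
  complex.Im (u n) @[n --> \oo] --> complex.Im x -> ccvg u x.
Proof.
move=> ur ui.
apply: (ccvg_le (fun n => `|complex.Re (u n) - complex.Re x| + `|complex.Im (u n) - complex.Im x|)).
  move=> n; apply: le_trans (normc_ReIm _) _.
  by case: (u n) => ? ?; case: x {ur ui}.
rewrite -[0]addr0 -(normr0 R); apply: cvgD; apply: cvg_norm; exact/subr_cvg0.
Qed.

End Normc.

Section Mean.
Context {R : realType}.
Implicit Types (x y z a b : R[i]) (u v : nat -> R[i]) (p q : int -> R[i]).
Import Normc.
Local Open Scope complex_scope.

Lemma is_sumZ_ccvg {p z} : is_sumZ p z -> ccvg (symsum p) z.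
Proof. exact: cvgC_ccvg. Qed.

Definition mean (u : nat -> R[i]) (N : nat) : R[i] :=
  (N.+1%:R)^-1 * \sum_(0 <= n < N.+1) u n.

Definition has_mean (u : nat -> R[i]) (a : R[i]) := ccvg (mean u) a.

Lemma has_mean_ext {u v a} : u =1 v -> has_mean u a -> has_mean v a.
Proof. by move=> /funext ->. Qed.

Lemma normc_natV (N : nat) : normc ((N.+1%:R : R[i])^-1) = (N.+1%:R)^-1.
Proof.
rewrite normcV; congr (_ ^-1).
by rewrite -(rmorph_nat (real_complex R)) normc_real ger0_norm.
Qed.

Lemma mean_normc_le u (C : R) : (forall n, normc (u n) <= C) ->
  forall N, normc (mean u N) <= C.
Proof.
move=> uC N; rewrite normcM normc_natV ler_pdivrMl//.
apply: (le_trans (normc_sum _ _ _)).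
apply: (@le_trans _ _ (\sum_(0 <= n < N.+1) C)); first exact: ler_sum.
by rewrite sumr_const_nat subn0 mulr_natl.
Qed.

Lemma meanD u v N : mean (fun n => u n + v n) N = mean u N + mean v N.
Proof. by rewrite /mean big_split/= mulrDr. Qed.

Lemma meanMl y u N : mean (fun n => y * u n) N = y * mean u N.
Proof. by rewrite /mean -mulr_sumr mulrCA. Qed.

Lemma has_meanD {u v a b} : has_mean u a -> has_mean v b ->
  has_mean (fun n => u n + v n) (a + b).
Proof.
by move=> ua vb; apply: ccvg_ext (ccvgD ua vb) => n; rewrite meanD.
Qed.

Lemma has_meanMl {u a} y : has_mean u a -> has_mean (fun n => y * u n) (y * a).
Proof. by move=> ua; apply: ccvg_ext (ccvgMl y ua) => n; rewrite meanMl. Qed.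

Lemma has_meanB {u v a b} : has_mean u a -> has_mean v b ->
  has_mean (fun n => u n - v n) (a - b).
Proof.
move=> ua /(has_meanMl (-1)); rewrite mulN1r => vb.
by apply: has_mean_ext (has_meanD ua vb) => n; rewrite mulN1r.
Qed.

Lemma has_mean_conj {u a} : has_mean u a -> has_mean (fun n => conjc (u n)) (conjc a).
Proof.
move=> /ccvg_conj; apply: ccvg_ext => N.
by rewrite /mean rmorphM/= rmorph_sum/= fmorphV/= rmorph_nat.
Qed.

Lemma has_mean_symsum (w : int -> nat -> R[i]) (a : int -> R[i]) T :
  (forall k, has_mean (w k) (a k)) ->
  has_mean (fun n => symsum (w ^~ n) T) (symsum a T).
Proof.
move=> H; elim: T => [|T IH].
  by rewrite symsum0; apply: has_mean_ext (H 0) => n; rewrite symsum0.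
rewrite symsumS; apply: has_mean_ext (has_meanD (has_meanD IH (H T.+1%:Z)) (H (- T.+1%:Z))).
by move=> n; rewrite symsumS.
Qed.

Lemma has_mean_normc_le {u a} (C : R) : has_mean u a -> (forall n, normc (u n) <= C) ->
  normc a <= C.
Proof. by move=> ua /mean_normc_le uC; exact: ccvg_normc_le ua uC. Qed.

Lemma has_mean_cst a : has_mean (fun=> a) a.
Proof.
apply: ccvg_ext (ccvg_cst a) => N.
by rewrite /mean sumr_const_nat subn0 -[X in _ * X]mulr_natl mulKf ?pnatr_eq0.
Qed.

(** The geometric sums stay below 2 / |1 - z|, so averaging sends them to 0. *)
Lemma has_mean_geometric z : normc z = 1 -> z != 1 -> has_mean (fun n => z ^+ n) 0.
Proof.
move=> z1 zn1; have z10 : normc (1 - z) != 0.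
  by rewrite normc_eq0 subr_eq0 eq_sym.
have z1p : 0 < normc (1 - z) by rewrite lt_def z10 normc_ge0.
apply: (ccvg_le (fun N => (2 / normc (1 - z)) * harmonic N)) => [N|]; last first.
  by rewrite -[0](mulr0 (2 / normc (1 - z))); apply: cvgMr; exact: cvg_harmonic.
rewrite subr0 normcM normc_natV /harmonic/= mulrC ler_pM2r ?invr_gt0//.
rewrite ler_pdivlMr// -normcM mulrC big_mkord -opprB mulNr -subrX1 opprB.
by rewrite (le_trans (normcB _ _))// normc1 normcX z1 expr1n.
Qed.

(** The limit in [T] and the mean in [n] can be exchanged because the error [e T] is uniform in
    [n]. *)
Lemma has_mean_unif (y : nat -> nat -> R[i]) (a : nat -> R[i]) u b (e : nat -> R) :
  (forall T, has_mean (y T) (a T)) -> (forall T n, normc (y T n - u n) <= e T) ->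
  e T @[T --> \oo] --> (0 : R) -> ccvg a b -> has_mean u b.
Proof.
move=> ya yu e0 ab; apply/cvgrPdist_lt => d d0.
have d3 : 0 < d / 3 by rewrite divr_gt0.
have /cvgrPdist_lt/(_ _ d3)[T1 _ H1] := e0.
have /cvgrPdist_lt/(_ _ d3)[T2 _ H2] := ab.
pose T := maxn T1 T2.
have {}H1 := H1 T (leq_maxl _ _); have {}H2 := H2 T (leq_maxr _ _).
have /cvgrPdist_lt/(_ _ d3) := ya T; apply: filterS => N H3.
rewrite /= !sub0r !normrN !(ger0_norm (normc_ge0 _)) in H1 H2 H3 *.
have eT : normc (mean u N - mean (y T) N) <= e T.
  have -> : mean u N - mean (y T) N = mean (fun n => u n - y T n) N.
    by rewrite /mean -mulrBr -sumrB.
  by apply: mean_normc_le => n; rewrite normc_dist.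
rewrite (_ : mean u N - b = (mean u N - mean (y T) N) + (mean (y T) N - a T) + (a T - b)); last by ring.
apply: (le_lt_trans (normcD _ _)); have := normcD (mean u N - mean (y T) N) (mean (y T) N - a T).
have := ler_norm (e T); lra.
Qed.

End Mean.

(** * Almost periodic sequences *)

Section AlmostPeriodic.
Context {R : realType}.
Implicit Types (z : R[i]) (p q : int -> R[i]) (P : nat -> R[i]).
Import Normc.
Local Open Scope complex_scope.

Definition abs_summable p (C : R) := forall T, symsum (fun k => normc (p k)) T <= C.

Lemma normc_symsum_diff p T d :
  normc (symsum p (T + d) - symsum p T) <=
  symsum (fun k => normc (p k)) (T + d) - symsum (fun k => normc (p k)) T.
Proof.
elim: d => [|d IH]; first by rewrite addn0 !subrr normc0.
rewrite addnS !symsumS.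
set x := symsum p _ in IH *; set y := symsum p _ in IH *.
rewrite (_ : x + _ + _ - y = (x - y) + (p (T + d).+1%:Z + p (- (T + d).+1%:Z))); last by ring.
apply: (le_trans (normcD _ _)).
by have := normcD (p (T + d).+1%:Z) (p (- (T + d).+1%:Z)); lra.
Qed.

Lemma normc_symsum_le p T :
  normc (symsum p T) <= symsum (fun k => normc (p k)) T.
Proof.
elim: T => [|T IH]; first by rewrite !symsum0.
rewrite !symsumS; apply: (le_trans (normcD _ _)); rewrite lerD2r.
by apply: (le_trans (normcD _ _)); rewrite lerD2r.
Qed.

(** The tail of the absolute series serves all unimodular twists [w] at once; for twists z^(kn) this
    is uniformity in [n]. *)
Lemma uniform_tail p C : abs_summable p C ->
  exists2 e : nat -> R, e T @[T --> \oo] --> (0 : R) &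
  forall (w : int -> R[i]) s, (forall k, normc (w k) = 1) ->
    ccvg (symsum (fun k => p k * w k)) s ->
    forall T, normc (symsum (fun k => p k * w k) T - s) <= e T.
Proof.
move=> pC; set S := symsum (fun k => normc (p k)).
have Snd : {homo S : m n / (m <= n)%N >-> m <= n}.
  by apply/nondecreasing_seqP => n; rewrite /S symsumS -addrA lerDl addr_ge0// normc_ge0.
have cS : cvgn S by apply: nondecreasing_is_cvgn => //; exists C => _ [T _ <-]; exact: pC.
exists (fun T => limn S - S T) => [|w s w1 cs T].
  by rewrite -(subrr (limn S)); apply: cvgB => //; exact: cvg_cst.
rewrite normc_dist.
have c : ccvg (fun d => symsum (fun k => p k * w k) (d + T) - symsum (fun k => p k * w k) T)
    (s - symsum (fun k => p k * w k) T).
  apply: ccvgD (ccvg_cst _).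
  have := cs; rewrite /ccvg.
  by rewrite -(cvg_shiftn T (fun n => normc (symsum (fun k => p k * w k) n - s))).
apply: (ccvg_normc_le _ c) => d; rewrite addnC.
apply: (le_trans (normc_symsum_diff _ _ _)).
rewrite (_ : (fun k => normc (p k * w k)) = fun k => normc (p k)); last first.
  by apply/funext => k; rewrite normcM w1 mulr1.
rewrite lerD2r; exact: nondecreasing_cvgn_le.
Qed.

Lemma symsum_delta p (l : int) T :
  symsum (fun k => p k * (k == l)%:R) T = if (absz l <= T)%N then p l else 0.
Proof.
elim: T => [|T IH].
  rewrite symsum0 leqn0 absz_eq0 eq_sym; case: eqP => [->|_]; rewrite ?mulr1 ?mulr0//.
rewrite symsumS {}IH; have [lT|lT] := leqP (absz l) T.
  have n1 : (T.+1%:Z == l) = false by apply/eqP; lia.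
  have n2 : (- T.+1%:Z == l) = false by apply/eqP; lia.
  by rewrite leqW// n1 n2 !mulr0 !addr0.
rewrite add0r; have [<-|l1] := eqVneq T.+1%:Z l.
  have -> : (- T.+1%:Z == T.+1%:Z) = false by apply/eqP; lia.
  by rewrite absz_nat leqnn mulr1 mulr0 addr0.
rewrite mulr0 add0r; have [<-|l2] := eqVneq (- T.+1%:Z) l.
  by rewrite abszN absz_nat leqnn mulr1.
by rewrite mulr0 ifF//; apply/negP; move/eqP: l1; move/eqP: l2; lia.
Qed.

(** * Fourier-Bohr coefficients along the powers of a unimodular number of infinite order *)

Section Character.
Variable z : R[i].
Hypothesis (z1 : normc z = 1) (zn : forall k : int, k != 0 -> z ^ k != 1).

Let z0 : z != 0.
Proof. by rewrite -normc_eq0 z1 oner_eq0. Qed.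

Lemma normc_exprz (k : int) : normc (z ^ k) = 1.
Proof.
case: k => n; first by rewrite -exprnP normcX z1 expr1n.
by rewrite NegzE -exprz_inv -exprnP normcX normcV z1 invr1 expr1n.
Qed.

Lemma conjc_inv_normc1 (x : R[i]) : normc x = 1 -> conjc x = x^-1.
Proof.
move=> x1; have x0 : x != 0 by rewrite -normc_eq0 x1 oner_eq0.
by apply: (mulfI x0); rewrite mul_conjc x1 expr1n divff.
Qed.

Lemma has_mean_character (k : int) :
  has_mean (fun n => (z ^ k) ^+ n) (k == 0)%:R.
Proof.
have [->|k0] := eqVneq k 0.
  by apply: has_mean_ext (has_mean_cst 1) => n; rewrite expr0z expr1n.
by apply: has_mean_geometric; [exact: normc_exprz|exact: zn].
Qed.

(** [P] is an almost periodic sequence with frequencies [z ^ k] and Fourier-Bohr coefficients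
    [p k]. *)
Definition represents p P := forall n, ccvg (symsum (fun k => p k * (z ^ k) ^+ n)) (P n).

(** Orthogonality of the characters, applied to the partial sums and carried to the limit by
    [uniform_tail]. *)
Lemma represents_coef p P C : abs_summable p C -> represents p P ->
  forall l, has_mean (fun n => P n * (z ^ (- l)) ^+ n) (p l).
Proof.
move=> pC pP l; have [e e0 He] := uniform_tail p C pC.
apply: (has_mean_unif (fun T n => symsum (fun k => p k * (z ^ k) ^+ n) T * (z ^ (- l)) ^+ n)
   (fun T => symsum (fun k => p k * (k == l)%:R) T) _ _ e) => //.
- move=> T; apply: (has_mean_ext (u := fun n => symsum (fun k => p k * (z ^ (k - l)) ^+ n) T)).
    move=> n; rewrite /symsum mulr_suml; apply: eq_bigr => k _.
    by rewrite -mulrA -exprMn -expfzDr.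
  apply: (has_mean_symsum (fun k n => p k * (z ^ (k - l)) ^+ n)) => k.
  by apply: has_meanMl; rewrite -subr_eq0; exact: has_mean_character.
- move=> T n; rewrite -mulrBl normcM normcX normc_exprz expr1n mulr1.
  by apply: He => // k; rewrite normcX normc_exprz expr1n.
- apply: (ccvg_le (fun T => normc (symsum (fun k => p k * (k == l)%:R) T - p l))) => //.
  apply/cvgrPdist_lt => d d0; exists (absz l) => // T /= lT.
  by rewrite symsum_delta lT subrr normc0 subrr normr0.
Qed.

Lemma represents_normc p P C : abs_summable p C -> represents p P ->
  forall n, normc (P n) <= C.
Proof.
move=> pC pP n; apply: (ccvg_normc_le _ (pP n)) => T.
apply: (le_trans (normc_symsum_le _ _)); apply: le_trans (pC T).
rewrite (_ : (fun k => normc (p k * _)) = fun k => normc (p k))//.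
by apply/funext => k; rewrite normcM normcX normc_exprz expr1n mulr1.
Qed.

(** The autocorrelation at [m] is the mean of |P n|^2 z^(-mn). Only one of the two factors is
    expanded and truncated, so the error is a uniform tail times [C]. *)
Lemma represents_autocorrelation p q P Q C : abs_summable p C -> abs_summable q C ->
  represents p P -> represents q Q -> (forall n, normc (P n) = normc (Q n)) ->
  forall m, ccvg (symsum (fun k => p k * conjc (p (k - m)) - q k * conjc (q (k - m)))) 0.
Proof.
move=> pC qC pP qQ PQ m.
have [e e0 He] := uniform_tail p C pC; have [f f0 Hf] := uniform_tail q C qC.
have zX k n : normc ((z ^ k) ^+ n) = 1 by rewrite normcX normc_exprz expr1n.
(* The other factor stays whole: its mean against a conjugate character yields the coefficient
   [conjc (r (k - m))]. *)
have half r F : abs_summable r C -> represents r F -> forall T,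
    has_mean (fun n => symsum (fun k => r k * (z ^ k) ^+ n) T * conjc (F n) * (z ^ (- m)) ^+ n)
      (symsum (fun k => r k * conjc (r (k - m))) T).
  move=> rC rF T.
  apply: (has_mean_ext (u := fun n => symsum
      (fun k => r k * conjc (F n * (z ^ (- (k - m))) ^+ n)) T)).
    move=> n; rewrite /symsum !mulr_suml; apply: eq_bigr => k _.
    rewrite rmorphM/= (conjc_inv_normc1 _ (zX _ _)) -exprVn invr_expz opprK.
    by rewrite expfzDr// exprMn; ring.
  apply: (has_mean_symsum (fun k n => r k * conjc (F n * (z ^ (- (k - m))) ^+ n))) => k.
  by apply: has_meanMl; apply: has_mean_conj; exact: represents_coef rC rF _.
have C0 : 0 <= C by apply: le_trans (normc_ge0 _) (represents_normc p P C pC pP 0).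
apply: (ccvg_le (fun T => (e T + f T) * C)) => [T|]; last first.
  rewrite -(mul0r C) -[X in X * C](addr0 0); apply: cvgMl; exact: cvgD.
rewrite subr0.
have -> : symsum (fun k => p k * conjc (p (k - m)) - q k * conjc (q (k - m))) T =
   symsum (fun k => p k * conjc (p (k - m))) T - symsum (fun k => q k * conjc (q (k - m))) T.
  by rewrite /symsum sumrB.
apply: has_mean_normc_le (has_meanB (half p P pC pP T) (half q Q qC qQ T)) _ => n.
set x := symsum _ T; set y := symsum _ T.
have PPQQ : P n * conjc (P n) = Q n * conjc (Q n).
  by rewrite !mul_conjc PQ.
(* Equal moduli cancel the main terms and leave only the two truncation errors. *)
rewrite (_ : _ - _ = ((x - P n) * conjc (P n) - (y - Q n) * conjc (Q n)) * (z ^ (- m)) ^+ n); last first.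
  by rewrite !mulrBl PPQQ; ring.
rewrite normcM zX mulr1; apply: (le_trans (normcB _ _)).
rewrite !normcM !normc_conj mulrDl.
apply: lerD; apply: ler_pM; rewrite ?normc_ge0//.
- exact: He.
- exact: represents_normc pC pP n.
- exact: Hf.
- exact: represents_normc qC qQ n.
Qed.

End Character.
End AlmostPeriodic.

(** * The Fourier transform of the Gaussian *)

Section GaussianIntegral.
Context {R : realType}.
Let mu := @lebesgue_measure R.
Implicit Types (f F : R -> R).

Lemma Rintegral_dominated (f_ : nat -> R -> R) f (g : R -> R) :
  (forall n, measurable_fun [set: R] (f_ n)) ->
  (forall x, f_ n x @[n --> \oo] --> f x) ->
  mu.-integrable setT (EFin \o g) -> (forall n x, `|f_ n x| <= g x) ->
  (\int[mu]_x f_ n x) @[n --> \oo] --> \int[mu]_x f x.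
Proof.
move=> mf ff ig fg.
have mfE n : measurable_fun [set: R] (fun x => (f_ n x)%:E) by apply/measurable_EFinP.
have ffE x : [set: R] x -> (f_ n x)%:E @[n --> \oo] --> (f x)%:E.
  by move=> _; apply: cvg_EFin; [exact: nearW|exact: ff].
have mf' : measurable_fun [set: R] (fun x => (f x)%:E).
  by apply: (emeasurable_fun_cvg (fun n x => (f_ n x)%:E)) => //.
have [] := @dominated_convergence _ _ _ mu setT measurableT (fun n x => (f_ n x)%:E)
  (fun x => (f x)%:E) (EFin \o g) mfE mf' _ ig.
- by apply: aeW => x; exact: ffE.
- by apply: aeW => x n _; rewrite /= lee_fin.
move=> fi _ c; apply: fine_cvg; rewrite fineK//; exact: integrable_fin_num.
Qed.

Lemma Rintegral_derive0 f F : (forall x : R, is_derive x 1 F (f x)) ->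
  continuous f -> mu.-integrable setT (EFin \o f) ->
  F n%:R @[n --> \oo] --> (0 : R) -> F (- n%:R) @[n --> \oo] --> (0 : R) ->
  \int[mu]_x f x = 0.
Proof.
move=> dF cf fi Fy FNy.
have mf : measurable_fun [set: R] f by exact: continuous_measurable_fun.
pose f_ (n : nat) := f \_ `[- n%:R, n%:R].
have c1 : (\int[mu]_x f_ n x) @[n --> \oo] --> \int[mu]_x f x.
  apply: (Rintegral_dominated _ _ (fun x => `|f x|)).
  - move=> n; apply: (measurable_restrictT f (measurable_itv `[- n%:R : R, n%:R])).1.
    by apply: measurable_funTS.
  - move=> x; apply/cvgrPdist_lt => e e0; exists (Num.truncn `|x|).+1 => // n /= xn.
    rewrite /f_ patchE mem_set ?subrr ?normr0//= in_itv/= -ler_norml.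
    by apply: (ltW (lt_le_trans (truncnS_gt _) _)); rewrite ler_nat.
  - exact: integrable_norm.
  - move=> n x; rewrite /f_ patchE; case: ifP => //; by rewrite normr0.
have cF x : {for x, continuous F}.
  by apply/differentiable_continuous/derivable1_diffP; case: (dF x).
(* The index starts at 1 because the fundamental theorem of calculus is applied on a nondegenerate
   interval. *)
have c2 : (\int[mu]_x f_ n.+1 x) @[n --> \oo] --> (0 : R).
  have c : (fun n => F n%:R - F (- n%:R)) @ \oo --> (0 - 0 : R) by apply: cvgB.
  rewrite subr0 -(cvg_shiftS (fun n => F n%:R - F (- n%:R))) in c.
  apply: cvg_trans c; apply: near_eq_cvg; apply: nearW => n.
  rewrite -Rintegral_mkcond /Rintegral (@continuous_FTC2 _ f F) //.
  - by rewrite gtrN.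
  - by apply: continuous_subspaceT => x; exact: cf.
  - split => [x _|//|].
    + by case: (dF x).
    + exact/cvg_at_right_filter/cF.
    + exact/cvg_at_left_filter/cF.
  - by move=> x _; rewrite derive1E; case: (dF x).
rewrite (cvg_shiftS (fun n => \int[mu]_x f_ n x)) in c2.
exact: cvg_unique c1 c2.
Qed.

End GaussianIntegral.

(** * Gaussian integrals against cosines, by a differential equation in the frequency *)

Section Gauss.
Context {R : realType}.
Let mu := @lebesgue_measure R.

Definition gauss (c m t : R) : R := expR (- (c * (t - m) ^+ 2)).

(** A multiple of the normal density of variance 1/(2c). The value of the integral stays implicit:
    positivity and independence of [m] are what later steps use. *)
Lemma gauss_integral (c : R) : 0 < c -> exists2 I : R, 0 < I &
  forall m, mu.-integrable setT (EFin \o gauss c m) /\ \int[mu]_t gauss c m t = I.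
Proof.
move=> c0; pose s := Num.sqrt ((2 * c)^-1).
have s0 : s != 0 by rewrite gt_eqF// sqrtr_gt0 invr_gt0 mulr_gt0.
have p0 := normal_peak_gt0 s0.
exists (normal_peak s)^-1 => [|m]; first by rewrite invr_gt0.
have E : gauss c m = (fun t => (normal_peak s)^-1 * normal_pdf m s t).
  apply/funext => t; rewrite normal_pdfE// mulKf ?gt_eqF//.
  rewrite /gauss /normal_fun sqr_sqrtr ?invr_ge0 ?mulr_ge0 ?(ltW c0)//.
  by congr expR; rewrite -mulr_natl; field; rewrite gt_eqF.
have i1 := integrable_normal_pdf m s; rewrite E; split.
  by apply: eq_integrable (integrableZl _ _ i1) => //.
rewrite RintegralZl// /Rintegral integral_normal_pdf /=.
by rewrite mulr1.
Qed.

Lemma gauss_derive c m (t : R) : is_derive t 1 (gauss c m) (- (2 * c * (t - m)) * gauss c m t).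
Proof.
rewrite -[gauss c m]/(fun t => expR (- (c * (t - m) ^+ 2))).
apply: is_derive_eq; rewrite /gauss /GRing.scale /=; ring.
Qed.

Lemma gauss_continuous c m : continuous (gauss c m).
Proof.
move=> t; apply: (continuous_comp (f := fun t => - (c * (t - m) ^+ 2)) (g := expR)); last exact: continuous_expR.
by apply/differentiable_continuous/derivable1_diffP.
Qed.

Section Fourier.
Variables (m th : R).

Let g := gauss (2 * pi) m.
(** The free phase [th] covers real and imaginary parts together, the latter being a shift by
    pi/2. *)
Let K (w : R) := \int[mu]_t (g t * cos (2 * pi * w * (t - m) + th)).

Let F w t := g t * sin (2 * pi * w * (t - m) + th).

Lemma gauss_sin_derive w (t : R) : is_derive t 1 (F w)
   (2 * pi * w * (g t * cos (2 * pi * w * (t - m) + th)) - 4 * pi * (t - m) * g t * sin (2 * pi * w * (t - m) + th)).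
Proof.
rewrite /F; have := gauss_derive (2 * pi) m t; rewrite -/g => dg.
apply: is_derive_eq; rewrite /GRing.scale /=; ring.
Qed.

Lemma continuous_cos_phase w : continuous (fun t : R => cos (2 * pi * w * (t - m) + th)).
Proof. by move=> t; apply/differentiable_continuous/derivable1_diffP. Qed.

Lemma continuous_sin_phase w : continuous (fun t : R => sin (2 * pi * w * (t - m) + th)).
Proof. by move=> t; apply/differentiable_continuous/derivable1_diffP. Qed.

Lemma continuous_moment : continuous (fun t : R => 2 * pi * (t - m)).
Proof. by move=> t; apply/differentiable_continuous/derivable1_diffP. Qed.

Lemma gauss_integrable : mu.-integrable setT (EFin \o g).
Proof.
have c0 : 0 < 2 * pi :> R by rewrite mulr_gt0// pi_gt0.
by have [I _ /(_ m)[]] := gauss_integral (2 * pi) c0.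
Qed.

Lemma continuous_le_integrable (f h : R -> R) : continuous f -> mu.-integrable setT (EFin \o h) ->
  (forall t, `|f t| <= h t) -> mu.-integrable setT (EFin \o f).
Proof.
move=> cf ih fh; apply: le_integrable ih => //.
  by apply/measurable_EFinP; exact: continuous_measurable_fun.
by move=> t _; rewrite /= lee_fin (le_trans (fh t))// ler_norm.
Qed.

Lemma gauss_cos_integrable w : mu.-integrable setT
  (EFin \o (fun t => g t * cos (2 * pi * w * (t - m) + th))).
Proof.
apply: continuous_le_integrable gauss_integrable _ => t.
  by apply: cvgM; [exact: gauss_continuous|exact: continuous_cos_phase].
rewrite normrM (ger0_norm (expR_ge0 _)) ler_piMr ?expR_ge0//.
by rewrite ler_norml cos_geN1 cos_le1.
Qed.

(** Half of the exponent absorbs the linear factor. The majorant is free of [w], as differentiation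
    under the integral requires. *)
Lemma gauss_moment_le t : `|2 * pi * (t - m) * g t| <= 2 * pi * gauss pi m t.
Proof.
have p0 : 0 < pi :> R := pi_gt0 R.
rewrite !normrM (ger0_norm (expR_ge0 _)) (ger0_norm (ltW p0)) ger0_norm// -mulrA.
rewrite ler_pM2l ?mulr_gt0// /g /gauss.
rewrite (_ : - (2 * pi * _) = - (pi * (t - m) ^+ 2) - pi * (t - m) ^+ 2); last by ring.
rewrite expRD mulrCA ler_piMr ?expR_ge0// expRN ler_pdivrMr ?expR_gt0// mul1r.
apply: le_trans (expR_ge1Dx _).
have p2 : 2 <= pi :> R := pi_ge2 R.
have := ler_wpM2r (sqr_ge0 (t - m)) p2.
rewrite -(@real_normK _ (t - m)) ?num_real//.
by have := sqr_ge0 (`|t - m| - 1); rewrite sqrrB1; have := sqr_ge0 `|t - m|; lra.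
Qed.

Lemma moment_integrable : mu.-integrable setT (EFin \o (fun t => 2 * pi * gauss pi m t)).
Proof.
have [I _ /(_ m)[ig _]] := gauss_integral pi (pi_gt0 R).
exact: (integrableZl _ _ ig).
Qed.

Let D w (t : R) := 2 * pi * (t - m) * g t * sin (2 * pi * w * (t - m) + th).

Lemma moment_sin_continuous w : continuous (D w).
Proof.
move=> t; apply: cvgM; last exact: continuous_sin_phase.
by apply: cvgM; [exact: continuous_moment|exact: gauss_continuous].
Qed.

Lemma moment_sin_le w t : `|D w t| <= 2 * pi * gauss pi m t.
Proof.
rewrite /D normrM (le_trans _ (gauss_moment_le t))// ler_piMr ?normr_ge0//.
by rewrite ler_norml sin_geN1 sin_le1.
Qed.

Lemma moment_sin_integrable w : mu.-integrable setT (EFin \o D w).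
Proof.
apply: continuous_le_integrable moment_integrable (moment_sin_le w); exact: moment_sin_continuous.
Qed.

Lemma gauss_le_exp t : g t <= expR (1 + `|m|) * expR (- `|t|).
Proof.
rewrite -expRD ler_expR.
have p2 : 2 <= pi :> R := pi_ge2 R.
have := ler_wpM2r (sqr_ge0 (t - m)) p2.
have := ler_normD (t - m) m; rewrite subrK -(@real_normK _ (t - m)) ?num_real//.
by have := sqr_ge0 (`|t - m| - 1); rewrite sqrrB1; have := sqr_ge0 `|t - m|; lra.
Qed.

Lemma gauss_sin_cvg0 w (s : R) : `|s| = 1 -> F w (s * n%:R) @[n --> \oo] --> (0 : R).
Proof.
move=> s1; apply: (cvg0_norm_le _ (geometric (expR (1 + `|m|)) (expR (- 1)))) => [n|].
  rewrite /F normrM (ger0_norm (expR_ge0 _)).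
  apply: (@le_trans _ _ (g (s * n%:R))).
    by rewrite ler_piMr ?expR_ge0// ler_norml sin_geN1 sin_le1.
  apply: (le_trans (gauss_le_exp _)).
  by rewrite normrM s1 mul1r normr_nat /geometric /= -[- n%:R]mulN1r expRM_natr.
by apply: cvg_geometric; rewrite ger0_norm ?expR_ge0// expR_lt1.
Qed.

(** Integration by parts: the derivative of [F w], which vanishes at both ends, has integral 0. *)
Lemma moment_sin_integral w : \int[mu]_t D w t = pi * w * K w.
Proof.
pose f t := 2 * pi * w * (g t * cos (2 * pi * w * (t - m) + th)) - 2 * D w t.
have fi1 := integrableZl measurableT (2 * pi * w) (gauss_cos_integrable w).
have fi2 := integrableZl measurableT 2 (moment_sin_integrable w).
have f0 : \int[mu]_t f t = 0.
  apply: (Rintegral_derive0 f (F w)).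
  - by move=> t; apply: is_derive_eq (gauss_sin_derive w t) _; rewrite /f /D; ring.
  - move=> t; apply: cvgB.
      apply: cvgM; first exact: cvg_cst.
      by apply: cvgM; [exact: gauss_continuous|exact: continuous_cos_phase].
    by apply: cvgM; [exact: cvg_cst|exact: moment_sin_continuous].
  - exact: (integrableB _ fi1 fi2).
  - by have := gauss_sin_cvg0 w 1 (normr1 _); under eq_fun do rewrite mul1r.
  - by have := gauss_sin_cvg0 w (-1) (normrN1 _); under eq_fun do rewrite mulN1r.
move: f0; rewrite RintegralB// (RintegralZl _ measurableT (gauss_cos_integrable w)).
rewrite (RintegralZl _ measurableT (moment_sin_integrable w)) -/(K w) => f0; lra.
Qed.

Lemma gauss_cos_integral_derive (w : R) : is_derive w 1 K (- (pi * w) * K w).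
Proof.
pose f (v t : R) := g t * cos (2 * pi * v * (t - m) + th).
have df (v t : R) : is_derive v 1 (f ^~ t) (- D v t).
  by apply: is_derive_eq; rewrite /D /GRing.scale /=; ring.
have d1 (v t : R) : partial1of2 f v t = - D v t by rewrite partial1of2E; case: (df v t).
have wI : `]w - 1, w + 1[%classic w.
  by rewrite /= in_itv/= ltrBlDr ltrDl ltr01.
have G0 (t : R) : 0 <= 2 * pi * gauss pi m t by rewrite (le_trans (normr_ge0 _) (gauss_moment_le t)).
have derf (v t : R) : `]w - 1, w + 1[%classic v -> [set: R] t -> derivable (f ^~ t) v 1.
  by move=> _ _; case: (df v t).
have dle (v t : R) : `]w - 1, w + 1[%classic v -> [set: R] t ->
    `|partial1of2 f v t| <= 2 * pi * gauss pi m t.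
  by move=> _ _; rewrite d1 normrN; exact: moment_sin_le.
have KE (v : R) : `]w - 1, w + 1[%classic v -> mu.-integrable setT (EFin \o f v).
  by move=> _; exact: gauss_cos_integrable.
apply: DeriveDef.
  exact: (derivable_under_integral measurableT wI KE derf G0 moment_integrable dle).
rewrite -derive1E.
rewrite (differentiation_under_integral measurableT wI KE derf G0 moment_integrable dle).
under eq_Rintegral do rewrite d1 -mulN1r.
rewrite (RintegralZl _ measurableT (moment_sin_integrable w)) moment_sin_integral; ring.
Qed.

Lemma gauss_cos_integral w : K w = K 0 * expR (- (pi * w ^+ 2 / 2)).
Proof.
(* Integrating factor for the equation K' = - pi w K. *)
pose L v := K v * expR (pi * v ^+ 2 / 2).
have dL (v : R) : is_derive v (1 : R) L 0.
  have dK := gauss_cos_integral_derive v.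
  by apply: is_derive_eq; rewrite /GRing.scale /=; field.
have := @is_derive_0_is_cst _ L w 0 dL.
rewrite /L expr0n mulr0 mul0r expR0 mulr1 => <-.
by rewrite -mulrA -expRD subrr expR0 mulr1.
Qed.

End Fourier.
Lemma gauss_fourier (w : R) : exists2 k : R, 0 < k & forall m th,
  \int[mu]_t (gauss (2 * pi) m t * cos (2 * pi * w * (t - m) + th)) = k * cos th.
Proof.
have c0 : 0 < 2 * pi :> R by rewrite mulr_gt0// pi_gt0.
have [I I0 HI] := gauss_integral _ c0.
exists (I * expR (- (pi * w ^+ 2 / 2))) => [|m th]; first by rewrite mulr_gt0// expR_gt0.
rewrite gauss_cos_integral; have [ig <-] := HI m.
under eq_Rintegral do rewrite mulr0 mul0r add0r mulrC.
by rewrite (RintegralZl _ measurableT ig); ring.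
Qed.

End Gauss.

(** * The Gabor transform on the shift-invariant space *)

Section ComplexIntegral.
Context {R : realType}.
Let mu := @lebesgue_measure R.
Implicit Types (f g : R -> R[i]) (c z : R[i]).
Local Open Scope complex_scope.
Import Normc.

Lemma cintegralD {f g} : cintegrable f -> cintegrable g ->
  cintegrable (fun t => f t + g t) /\
  cintegral (fun t => f t + g t) = cintegral f + cintegral g.
Proof.
move=> [fr fi] [gr gi].
have rE t : complex.Re (f t + g t) = complex.Re (f t) + complex.Re (g t).
  by case: (f t) => ? ?; case: (g t).
have iE t : complex.Im (f t + g t) = complex.Im (f t) + complex.Im (g t).
  by case: (f t) => ? ?; case: (g t).
split; first split.
- by under eq_fun do rewrite rE; exact: (integrableD _ fr gr).
- by under eq_fun do rewrite iE; exact: (integrableD _ fi gi).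
- have rI : \int[mu]_t complex.Re (f t + g t) =
      \int[mu]_t complex.Re (f t) + \int[mu]_t complex.Re (g t).
    by under eq_Rintegral do rewrite rE; rewrite RintegralD.
  have iI : \int[mu]_t complex.Im (f t + g t) =
      \int[mu]_t complex.Im (f t) + \int[mu]_t complex.Im (g t).
    by under eq_Rintegral do rewrite iE; rewrite RintegralD.
  by rewrite /cintegral rI iI.
Qed.

Lemma cintegralMl c {f} : cintegrable f ->
  cintegrable (fun t => c * f t) /\ cintegral (fun t => c * f t) = c * cintegral f.
Proof.
case: c => a b [fr fi].
have rE t : complex.Re ((a +i* b) * f t) = a * complex.Re (f t) - b * complex.Im (f t).
  by case: (f t).
have iE t : complex.Im ((a +i* b) * f t) = a * complex.Im (f t) + b * complex.Re (f t).
  by case: (f t).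
have Zr r : mu.-integrable setT (EFin \o (fun t => r * complex.Re (f t))).
  exact: (integrableZl measurableT r fr).
have Zi r : mu.-integrable setT (EFin \o (fun t => r * complex.Im (f t))).
  exact: (integrableZl measurableT r fi).
have fr' : mu.-integrable setT (EFin \o (fun t => complex.Re (f t))) by [].
have fi' : mu.-integrable setT (EFin \o (fun t => complex.Im (f t))) by [].
split; first split.
- by under eq_fun do rewrite rE; exact: (integrableB _ (Zr a) (Zi b)).
- by under eq_fun do rewrite iE; exact: (integrableD _ (Zi a) (Zr b)).
- have rI : \int[mu]_t complex.Re ((a +i* b) * f t) =
      a * \int[mu]_t complex.Re (f t) - b * \int[mu]_t complex.Im (f t).
    by under eq_Rintegral do rewrite rE; rewrite (RintegralB measurableT (Zr a) (Zi b)) (RintegralZl _ measurableT fr') (RintegralZl _ measurableT fi').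
  have iI : \int[mu]_t complex.Im ((a +i* b) * f t) =
      a * \int[mu]_t complex.Im (f t) + b * \int[mu]_t complex.Re (f t).
    by under eq_Rintegral do rewrite iE; rewrite RintegralD// !RintegralZl.
  by rewrite /cintegral rI iI.
Qed.

Lemma cintegral_symsum (F : int -> R -> R[i]) T : (forall k, cintegrable (F k)) ->
  cintegrable (fun t => symsum (F ^~ t) T) /\
  cintegral (fun t => symsum (F ^~ t) T) = symsum (fun k => cintegral (F k)) T.
Proof.
move=> iF; elim: T => [|T [i1 i2]].
  by rewrite (_ : (fun t => _) = F 0) ?symsum0//; apply/funext => t; rewrite symsum0.
have [j1 j2] := cintegralD i1 (iF T.+1%:Z).
have [k1 k2] := cintegralD j1 (iF (- T.+1%:Z)).
have -> : (fun t => symsum (F ^~ t) T.+1) =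
    (fun t => symsum (F ^~ t) T + F T.+1%:Z t + F (- T.+1%:Z) t).
  by apply/funext => t; rewrite symsumS.
by split=> //; rewrite k2 j2 i2 symsumS.
Qed.

Lemma cintegral_dominated (F : nat -> R -> R[i]) f (G : R -> R) :
  (forall T, cintegrable (F T)) -> (forall t, ccvg (F ^~ t) (f t)) ->
  mu.-integrable setT (EFin \o G) -> (forall T t, normc (F T t) <= G t) ->
  ccvg (fun T => cintegral (F T)) (cintegral f).
Proof.
move=> iF Ff iG FG; apply: ccvg_ReIm => /=.
- apply: (Rintegral_dominated _ _ G) => //.
  + by move=> T; have [/measurable_int/measurable_EFinP] := iF T.
  + by move=> t; exact: ccvg_Re (Ff t).
  + by move=> T t; exact: le_trans (normc_Re _) (FG T t).
- apply: (Rintegral_dominated _ _ G) => //.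
  + by move=> T; have [_ /measurable_int/measurable_EFinP] := iF T.
  + by move=> t; exact: ccvg_Im (Ff t).
  + by move=> T t; exact: le_trans (normc_Im _) (FG T t).
Qed.

Lemma normc_expi (y : R) : normc (expi y) = 1.
Proof. by rewrite /= cos2Dsin2 sqrtr1. Qed.

Lemma expiD (x y : R) : expi (x + y) = expi x * expi y.
Proof. by rewrite /expi cosD sinD; congr (_ +i* _); ring. Qed.

Lemma gaussian_prod (a x t : R) : gaussian (t - a) * gaussian (t - x) =
  expR (- (pi * (a - x) ^+ 2 / 2)) * gauss (2 * pi) ((a + x) / 2) t.
Proof. by rewrite /gaussian /gauss -!expRD; congr expR; field. Qed.

Lemma gaussian_integrable (x : R) : mu.-integrable setT (EFin \o (fun t => gaussian (t - x))).
Proof. by have [I _ /(_ x)[]] := gauss_integral pi (pi_gt0 R). Qed.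

(** The product of the two Gaussians is a Gaussian centred at the midpoint of [a] and [x], to which
    [gauss_fourier] applies with phases differing by pi/2. The constant [k] depends on [w] alone. *)
Lemma gabor_atom (w : R) : exists2 k : R, 0 < k & forall a x,
  cintegrable (fun t => (gaussian (t - a))%:C * (gaussian (t - x))%:C *
     expi (- (2 * pi * t * w))) /\
  cintegral (fun t => (gaussian (t - a))%:C * (gaussian (t - x))%:C *
     expi (- (2 * pi * t * w))) =
   (k * expR (- (pi * (a - x) ^+ 2 / 2)))%:C * expi (- (pi * w * (a + x))).
Proof.
have [k k0 Hk] := gauss_fourier w; exists k => // a x.
set E := expR _; set m := (a + x) / 2.
have rE t : complex.Re ((gaussian (t - a))%:C * (gaussian (t - x))%:C * expi (- (2 * pi * t * w)))
   = E * (gauss (2 * pi) m t * cos (2 * pi * w * (t - m) + pi * w * (a + x))).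
  rewrite -rmorphM gaussian_prod -/E -/m /= mul0r subr0 cosN mulrA; congr (_ * cos _).
  by rewrite /m; field.
have iE t : complex.Im ((gaussian (t - a))%:C * (gaussian (t - x))%:C * expi (- (2 * pi * t * w)))
   = E * (gauss (2 * pi) m t * cos (2 * pi * w * (t - m) + (pi * w * (a + x) + pi / 2))).
  rewrite -rmorphM gaussian_prod -/E -/m /= mul0r addr0 sinN -cosDpihalf mulrA.
  by congr (_ * cos _); rewrite /m; field.
have i1 := gauss_cos_integrable m (pi * w * (a + x)) w.
have i2 := gauss_cos_integrable m (pi * w * (a + x) + pi / 2) w.
split; first split.
- by under eq_fun do rewrite rE; exact: (integrableZl measurableT E i1).
- by under eq_fun do rewrite iE; exact: (integrableZl measurableT E i2).
have rI : \int[mu]_t complex.Re ((gaussian (t - a))%:C * (gaussian (t - x))%:C *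
    expi (- (2 * pi * t * w))) = E * (k * cos (pi * w * (a + x))).
  by under eq_Rintegral do rewrite rE; rewrite (RintegralZl _ measurableT i1) Hk.
have iI : \int[mu]_t complex.Im ((gaussian (t - a))%:C * (gaussian (t - x))%:C *
    expi (- (2 * pi * t * w))) = E * (k * - sin (pi * w * (a + x))).
  by under eq_Rintegral do rewrite iE; rewrite (RintegralZl _ measurableT i2) Hk cosDpihalf.
rewrite /cintegral rI iI.
by rewrite /expi cosN sinN; apply/eqP; rewrite eq_complex /=; apply/andP; split; apply/eqP; ring.
Qed.

Lemma in_l1Z_bounded {c : int -> R[i]} : in_l1Z c ->
  exists C, forall T, symsum (fun k => normc (c k)) T <= C.
Proof.
rewrite /in_l1Z summableE => cl; exists (fine (\esum_(k in [set: int]) `|(normc (c k))%:E|)%E) => T.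
rewrite -lee_fin fineK// esum_ge//.
pose s := [seq k%:Z - T%:Z | k <- index_iota 0 (2 * T).+1].
exists [set` s]; first by split => //; exact: finite_seq.
rewrite -fsbig_seq; last by rewrite map_inj_uniq ?iota_uniq// => i j /addIr[].
rewrite /s big_map /symsum -sumEFin; apply: lee_sum => k _.
by rewrite lee_fin ler_norm.
Qed.

(** Termwise integration, dominated by [C * gaussian (t - x)] since every translate is at most 1. As
    [k] depends on [w] alone, it is common to [f] and [h]. *)
Lemma gabor_series (w : R) : exists2 k : R, 0 < k &
  forall beta (f : R -> R[i]) (c : int -> R[i]) C x,
  (forall T, symsum (fun k => normc (c k)) T <= C) ->
  (forall t, is_sumZ (fun k => c k * (gaussian (t - beta * k%:~R))%:C) (f t)) ->
  ccvg (symsum (fun n => c n * ((k * expR (- (pi * (beta * n%:~R - x) ^+ 2 / 2)))%:C *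
      expi (- (pi * w * (beta * n%:~R + x)))))) (gabor f x w).
Proof.
have [k k0 Hk] := gabor_atom w; exists k => // beta f c C x cC fE.
pose A n t := c n * ((gaussian (t - beta * n%:~R))%:C * (gaussian (t - x))%:C *
     expi (- (2 * pi * t * w))).
have iA n : cintegrable (A n) by have [] := cintegralMl (c n) (Hk (beta * n%:~R) x).1.
have AE T : cintegral (fun t => symsum (A ^~ t) T) =
    symsum (fun n => c n * ((k * expR (- (pi * (beta * n%:~R - x) ^+ 2 / 2)))%:C *
      expi (- (pi * w * (beta * n%:~R + x))))) T.
  rewrite (cintegral_symsum _ _ iA).2; congr symsum; apply/funext => n.
  by have [i1 i2] := Hk (beta * n%:~R) x; rewrite (cintegralMl (c n) i1).2 i2.
pose e t := (gaussian (t - x))%:C * expi (- (2 * pi * t * w)).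
have FE T t : symsum (A ^~ t) T =
    e t * symsum (fun n => c n * (gaussian (t - beta * n%:~R))%:C) T.
  by rewrite /symsum mulr_sumr; apply: eq_bigr => n _; rewrite /A /e; ring.
have C0 : 0 <= C by apply: le_trans (cC 0%N); rewrite symsum0 normc_ge0.
have g0 (s : R) : 0 <= gaussian s by exact: expR_ge0.
have g1 (s : R) : gaussian s <= 1.
  by rewrite -expR0 ler_expR oppr_le0 mulr_ge0 ?pi_ge0 ?sqr_ge0.
apply: (ccvg_ext (u := fun T => cintegral (fun t => symsum (A ^~ t) T))) => //.
apply: (cintegral_dominated _ _ (fun t => C * gaussian (t - x))).
- by move=> T; exact: (cintegral_symsum _ _ iA).1.
- move=> t; rewrite -mulrA mulrC.
  apply: ccvg_ext (ccvgMl (e t) (is_sumZ_ccvg (fE t))) => T; exact/esym/FE.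
- exact: (integrableZl measurableT C (gaussian_integrable x)).
- move=> T t; rewrite FE normcM mulrC {1}/e normcM normc_expi mulr1 normc_real (ger0_norm (g0 _)).
  apply: ler_wpM2r; first exact: g0.
  apply: (le_trans (normc_symsum_le _ _)); apply: le_trans (cC T).
  apply: ler_sum => n _; rewrite normcM normc_real (ger0_norm (g0 _)).
  by rewrite ler_piMr ?normc_ge0.
Qed.

End ComplexIntegral.

(** * Phase retrieval *)

Section Assembly.
Context {R : realType}.
Implicit Types (f h : R -> R[i]) (c d : int -> R[i]).
Local Open Scope complex_scope.
Import Normc.

Lemma expi0 : expi (0 : R) = 1.
Proof. by rewrite /expi cos0 sin0. Qed.

Lemma expiN (x : R) : expi (- x) = (expi x)^-1.
Proof.
have x0 : expi x != 0 by rewrite -normc_eq0 normc_expi oner_eq0.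
by apply: (mulfI x0); rewrite -expiD subrr expi0 divff.
Qed.

Lemma expiMn (x : R) (n : nat) : expi (x * n%:R) = expi x ^+ n.
Proof.
elim: n => [|n IH]; first by rewrite mulr0 expi0.
by rewrite -natr1 mulrDr mulr1 expiD IH exprSr.
Qed.

Lemma expiMz (x : R) (k : int) : expi (x * k%:~R) = expi x ^ k.
Proof.
case: k => n; first by rewrite -pmulrn expiMn.
by rewrite NegzE mulrNz mulrN expiN -pmulrn expiMn.
Qed.

(** Multiples of pi are enough for the irrationality argument: subtracting the floor multiple leaves
    a point of [0, pi) with zero sine, hence 0. *)
Lemma expi_eq1 (y : R) : expi y = 1 -> exists j : int, y = pi * j%:~R.
Proof.
move=> y1; pose j := Num.floor (y / pi); exists j.
have p0 : 0 < pi :> R := pi_gt0 R.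
have := floor_itv (y / pi); rewrite ler_pdivlMr// ltr_pdivrMr// -/j intrD mulrDl mul1r.
move=> /andP[jy yj]; apply/eqP; rewrite -subr_eq0; apply/eqP.
have sin0j : sin (y - pi * j%:~R) = 0.
  have : expi (y - pi * j%:~R) = (-1) ^ (- j).
    rewrite expiD y1 mul1r -mulrN -mulrNz expiMz.
    by rewrite {1}/expi cospi sinpi complexr0 rmorphN1.
  have -> : (-1 : R[i]) ^ (- j) = ((-1) ^ (- j))%:C.
    by case: (- j) => n; rewrite ?NegzE -?exprz_inv ?invrN1 -!exprnP rmorphXn rmorphN1.
  by move=> /(congr1 (@complex.Im R)).
apply/eqP; rewrite eq_le; apply/andP; split; last by rewrite subr_ge0 mulrC.
rewrite leNgt; apply/negP => yp.
have := @sin_gt0_pi R (y - pi * j%:~R); rewrite yp sin0j ltxx => /= H.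
by suff /H : y - pi * j%:~R < pi by []; rewrite ltrBlDr mulrC addrC.
Qed.

Lemma irrational_character (beta : R) : irrational beta ->
  forall k : int, k != 0 -> (expi (- (pi * beta))) ^ k != 1.
Proof.
move=> ib k k0; apply/negP => /eqP; rewrite -expiMz => /expi_eq1[j].
have p0 : pi != 0 :> R by rewrite gt_eqF ?pi_gt0.
have k0' : k%:~R != 0 :> R by rewrite intr_eq0.
rewrite mulNr -mulrA -mulrN => /(mulfI p0) E.
apply: ib; exists (- (j%:~R / k%:~R)) => //.
rewrite rmorphN/= fmorph_div/= !ratr_int -E.
by rewrite mulNr opprK mulfK.
Qed.

Lemma le_symsum (u : int -> R) : (forall k, 0 <= u k) ->
  forall k, exists T, u k <= symsum u T.
Proof.
move=> u0.
have s0 T : 0 <= symsum u T by apply: sumr_ge0 => i _.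
case=> [[|n]|n].
- by exists 0%N; rewrite symsum0.
- by exists n.+1; rewrite symsumS -addrA addrCA lerDl addr_ge0.
- by exists n.+1; rewrite symsumS NegzE lerDr addr_ge0.
Qed.

(** Lag 0 gives equal moduli; lag [k - k0], for a pivot with [d k0 != 0], compares every coefficient
    with the pivot, so the phase is [c k0 / d k0]. *)
Lemma phase_of_autocorrelation c d :
  (forall k m, c k * conjc (c (k - m)) = d k * conjc (d (k - m))) ->
  exists tau, normc tau = 1 /\ forall k, c k = tau * d k.
Proof.
move=> H.
have N k : normc (c k) = normc (d k).
  have := H k 0; rewrite subr0 !mul_conjc => /complexI/eqP.
  by rewrite eqrXn2 ?normc_ge0// => /eqP.
have [[k0 dk0]|d0] := pselect (exists k, d k != 0); last first.
  exists 1; rewrite normc1; split => // k; rewrite mul1r.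
  have dk : d k = 0 by apply/eqP; apply: contraT => dk; case: d0; exists k.
  by apply/eqP; rewrite dk -normc_eq0 N dk normc0.
have ck0 : c k0 != 0 by rewrite -normc_eq0 N normc_eq0.
exists (c k0 / d k0); split.
  by rewrite normcM normcV N divff// normc_eq0.
move=> k; have := H k (k - k0); rewrite subKr => E.
have cc0 : conjc (c k0) != 0 by rewrite conjc_eq0.
apply: (mulIf cc0); rewrite E.
rewrite (_ : c k0 / d k0 * d k * conjc (c k0) = (c k0 * conjc (c k0)) / d k0 * d k); last by ring.
by rewrite mul_conjc N -mul_conjc; field.
Qed.

(* Completing the square: the product of the two Gaussian weights is, up to a factor
   independent of k, the weight of a Laurent series at exp (2 pi beta (x + beta m / 2)). *)
Lemma gaussian_weights (beta x : R) (k m : int) :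
  expR (- (pi * (beta * k%:~R - x) ^+ 2 / 2)) *
  expR (- (pi * (beta * (k - m)%:~R - x) ^+ 2 / 2)) =
  expR (- (pi * ((beta * m%:~R) ^+ 2 / 2 + beta * m%:~R * x + x ^+ 2))) *
  (expR (- (pi * (beta * k%:~R) ^+ 2)) * expR (2 * pi * beta * (x + beta * m%:~R / 2)) ^ k).
Proof.
rewrite expR_exprz -!expRD; congr expR; rewrite intrB; by field.
Qed.

(** The discrete form of a density bound n/r, stable under translation, in which both sampling sets
    enter the argument. *)
Definition windows (L : set R) (r : R) (n : nat) := forall x : R, exists s : seq R,
  [/\ size s = n, uniq s & forall y, y \in s -> L y /\ x <= y < x + r].

Lemma windows_shift L r n (a : R) : windows L r n -> windows [set y | L (y - a)] r n.
Proof.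
move=> W x; have [s [ss us Hs]] := W (x - a).
exists [seq y + a | y <- s]; split; first by rewrite size_map.
  by rewrite map_inj_uniq// => y z /addIr.
by move=> _ /mapP[y /Hs[Ly /andP[y1 y2]] ->]; rewrite /= addrK; split=> //; apply/andP; split; lra.
Qed.

Lemma gabor_autocorrelation beta f h c d C (x : R) : irrational beta ->
  abs_summable c C -> abs_summable d C ->
  (forall t, is_sumZ (fun k => c k * (gaussian (t - beta * k%:~R))%:C) (f t)) ->
  (forall t, is_sumZ (fun k => d k * (gaussian (t - beta * k%:~R))%:C) (h t)) ->
  (forall n : int, `|gabor f x n%:~R| = `|gabor h x n%:~R|) ->
  forall m : int, ccvg (symsum (fun k => (c k * conjc (c (k - m)) - d k * conjc (d (k - m))) *
    (expR (- (pi * (beta * k%:~R) ^+ 2)) *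
       expR (2 * pi * beta * (x + beta * m%:~R / 2)) ^ k)%:C)) 0.
Proof.
move=> ib cC dC fE hE fh m.
set z := expi (- (pi * beta)).
pose g (k : int) : R := expR (- (pi * (beta * k%:~R - x) ^+ 2 / 2)).
have g0 k : 0 < g k by exact: expR_gt0.
have g1 k : g k <= 1.
  by rewrite -expR0 ler_expR oppr_le0 divr_ge0// mulr_ge0 ?pi_ge0 ?sqr_ge0.
have [kap kapP] := choice (fun n : nat => let: ex_intro2 k k0 Hk := gabor_series (R := R) n%:R in
  ex_intro (fun k => _ /\ _) k (conj k0 Hk)).
(* Dividing by the common constant and by the phase of [x] leaves the series of e_k g_k z^(kn), with
   nonnegative weights [g k] at most 1. *)
pose P (F : R -> R[i]) (n : nat) := ((kap n)^-1)%:C * expi (pi * n%:R * x) * gabor F x n%:R.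
have PP F e : abs_summable e C ->
    (forall t, is_sumZ (fun k => e k * (gaussian (t - beta * k%:~R))%:C) (F t)) ->
    represents z (fun k => e k * (g k)%:C) (P F).
  move=> eC FE n; have [k0 Hk] := kapP n.
  apply: ccvg_ext (ccvgMl (((kap n)^-1)%:C * expi (pi * n%:R * x)) (Hk beta F e C x eC FE)) => T.
  rewrite /symsum mulr_sumr; apply: eq_bigr => i _; set k := _ - _.
  have -> : (z ^ k) ^+ n = expi (pi * n%:R * x) * expi (- (pi * n%:R * (beta * k%:~R + x))).
    rewrite -expiD /z -expiMz -expiMn; congr expi; ring.
  have kk : ((kap n)^-1)%:C * (kap n)%:C = 1 :> R[i].
    by rewrite -rmorphM mulVf ?rmorph1// gt_eqF.
  rewrite -/(g k) rmorphM; move: kk; set u := _%:C; set v := _%:C => kk.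
  by rewrite -[RHS]mul1r -kk; ring.
have PC e : abs_summable e C -> abs_summable (fun k => e k * (g k)%:C) C.
  move=> eC T; apply: le_trans (eC T); apply: ler_sum => i _.
  by rewrite normcM normc_real (gtr0_norm (g0 _)) ler_piMr ?normc_ge0.
have fhP n : normc (P f n) = normc (P h n).
  rewrite !normcM; congr (_ * _).
  by apply: complexI; rewrite !normc_norm; have := fh n%:Z; rewrite -pmulrn.
have z1 : normc z = 1 by exact: normc_expi.
have zn := irrational_character beta ib.
have := represents_autocorrelation z z1 zn _ _ _ _ C (PC _ cC) (PC _ dC) (PP _ _ cC fE) (PP _ _ dC hE) fhP m.
(* The factor of [gaussian_weights] that does not depend on the summation index; it is divided
   out. *)
set S := expR (- (pi * ((beta * m%:~R) ^+ 2 / 2 + beta * m%:~R * x + x ^+ 2))).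
have S0 : S^-1%:C * S%:C = 1 by rewrite -rmorphM mulVf ?rmorph1// gt_eqF// expR_gt0.
move=> /(ccvgMl (S^-1)%:C); rewrite mulr0; apply: ccvg_ext => T.
rewrite /symsum mulr_sumr; apply: eq_bigr => i _; move: (i%:Z - T%:Z) => k.
have cE (u : R[i]) (r : R) : conjc (u * r%:C) = conjc u * r%:C.
  by rewrite rmorphM; congr (_ * _); exact: conjc_real.
cbv beta; rewrite !cE.
have E : (g k)%:C * (g (k - m))%:C = S%:C * (expR (- (pi * (beta * k%:~R) ^+ 2)) *
       expR (2 * pi * beta * (x + beta * m%:~R / 2)) ^ k)%:C.
  by rewrite -!rmorphM gaussian_weights.
move: E; set X := (_ * _ ^ k)%:C => E.
have -> : X = (S^-1)%:C * ((g k)%:C * (g (k - m))%:C) by rewrite E mulrA S0 mul1r.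
by ring.
Qed.

End Assembly.

(** * From sampling windows to the global phase *)

Section Main.
Context {R : realType}.
Implicit Types (f h : R -> R[i]) (c d : int -> R[i]).
Local Open Scope complex_scope.
Import Normc.

Lemma Re_symsum (u : int -> R[i]) (w : int -> R) T :
  complex.Re (symsum (fun k => u k * (w k)%:C) T) = symsum (fun k => complex.Re (u k) * w k) T.
Proof.
have M (x : R[i]) (b : R) : complex.Re (x * b%:C) = complex.Re x * b.
  by case: x => ? ?; rewrite /= mulr0 subr0.
have D (x y : R[i]) : complex.Re (x + y) = complex.Re x + complex.Re y.
  by case: x => ? ?; case: y.
by elim: T => [|T IH]; rewrite ?symsum0 ?M// !symsumS !D !M IH.
Qed.

Lemma Im_symsum (u : int -> R[i]) (w : int -> R) T :
  complex.Im (symsum (fun k => u k * (w k)%:C) T) = symsum (fun k => complex.Im (u k) * w k) T.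
Proof.
have M (x : R[i]) (b : R) : complex.Im (x * b%:C) = complex.Im x * b.
  by case: x => ? ?; rewrite /= mulr0 add0r.
have D (x y : R[i]) : complex.Im (x + y) = complex.Im x + complex.Im y.
  by case: x => ? ?; case: y.
by elim: T => [|T IH]; rewrite ?symsum0 ?M// !symsumS !D !M IH.
Qed.

Lemma gabor_phase (beta r : R) (n : nat) (L : set R) f h :
  0 < beta -> irrational beta -> 1 <= 2 * pi * beta * r -> 2 * r <= beta * n%:R ->
  windows L r n -> gaussian_SIS beta f -> gaussian_SIS beta h ->
  (forall (x : R) (k : int), L x -> `|gabor f x k%:~R| = `|gabor h x k%:~R|) ->
  exists tau : R[i], `|tau| = 1 /\ forall t, f t = tau * h t.
Proof.
move=> b0 ib br rn W [_ [c [c1 fE]]] [_ [d [d1 hE]]] fh.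
have [C1 cC1] := in_l1Z_bounded c1; have [C2 dC2] := in_l1Z_bounded d1.
pose C := Num.max C1 C2.
have cC : abs_summable c C by move=> T; rewrite le_max cC1.
have dC : abs_summable d C by move=> T; rewrite le_max dC2 orbT.
have coefC e k : abs_summable e C -> normc (e k) <= C.
  move=> eC; have [T HT] := le_symsum (fun k => normc (e k)) (fun k => normc_ge0 (e k)) k.
  exact: le_trans HT (eC T).
have C0 : 0 <= C by apply: le_trans (normc_ge0 _) (coefC c 0 cC).
have corr k m : c k * conjc (c (k - m)) = d k * conjc (d (k - m)).
  pose u (j : int) := c j * conjc (c (j - m)) - d j * conjc (d (j - m)).
  have uC j : normc (u j) <= C * C + C * C.
    apply: (le_trans (normcB _ _)); rewrite !normcM !normc_conj.
    by apply: lerD; apply: ler_pM; rewrite ?normc_ge0// coefC.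
  (* A sample [x] yields a zero at the abscissa x + beta m / 2, so for lag [m] the zeros are indexed
     by a translate of [L]. *)
  have WL := windows_shift L r n (beta * m%:~R / 2) W.
  have lim x : L (x - beta * m%:~R / 2) ->
      ccvg (symsum (fun k => u k * (expR (- (pi * (beta * k%:~R) ^+ 2)) *
       expR (2 * pi * beta * x) ^ k)%:C)) 0.
    move=> Lx; have := gabor_autocorrelation beta f h c d C _ ib cC dC fE hE
      (fun k => fh _ k Lx) m.
    by rewrite subrK.
  (* The weights and evaluation points are real, so the real and imaginary parts of [u] each give a
     real Laurent series with these zeros. *)
  have re0 : forall j, complex.Re (u j) = 0.
    apply: (gaussian_laurent_unique beta r (C * C + C * C) n _ _ b0 br rn WL).
      by move=> j; exact: le_trans (normc_Re _) (uC j).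
    move=> x /lim /ccvg_Re; apply: cvg_trans; apply: near_eq_cvg; apply: nearW => T.
    by rewrite Re_symsum; congr symsum; apply/funext => j; rewrite mulrA.
  have im0 : forall j, complex.Im (u j) = 0.
    apply: (gaussian_laurent_unique beta r (C * C + C * C) n _ _ b0 br rn WL).
      by move=> j; exact: le_trans (normc_Im _) (uC j).
    move=> x /lim /ccvg_Im; apply: cvg_trans; apply: near_eq_cvg; apply: nearW => T.
    by rewrite Im_symsum; congr symsum; apply/funext => j; rewrite mulrA.
  apply/eqP; rewrite -subr_eq0; apply/eqP; rewrite -/(u k).
  by apply/eqP; rewrite eq_complex re0 im0 !eqxx.
have [tau [tau1 ctau]] := phase_of_autocorrelation c d corr.
exists tau; split; first by rewrite -normc_norm tau1.
move=> t; apply: ccvg_unique (is_sumZ_ccvg (fE t)) _.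
apply: ccvg_ext (ccvgMl tau (is_sumZ_ccvg (hE t))) => T.
by rewrite /symsum mulr_sumr; apply: eq_bigr => k _; rewrite ctau mulrA.
Qed.

(** A lower limit above 2/beta makes every window of some large length [r] contain more than 2r/beta
    points. *)
Lemma windows_of_density (beta : R) (L : set R) : 0 < beta ->
  ((2 / beta)%:E < lower_beurling_density L)%E ->
  exists r n, [/\ 1 <= 2 * pi * beta * r, 2 * r <= beta * n%:R & windows L r n].
Proof.
move=> b0; rewrite /lower_beurling_density limf_einfE => /ereal_sup_gt[_ [V FV <-] bV].
have pb : 0 < 2 * pi * beta by rewrite !mulr_gt0// pi_gt0.
case: FV => M [_ MV].
(* [M + 1] puts [r] in the neighbourhood of +oo, 1 makes it positive, and the last entry gives 1 <=
   2 pi beta r. *)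
pose r := Num.max (Num.max (M + 1) 1) ((2 * pi * beta)^-1).
have r1 : 1 <= r by rewrite !le_max lexx !orbT.
have r0 : 0 < r by apply: lt_le_trans r1.
have Vr : V r by apply: MV; rewrite !lt_max ltrDl ltr01.
have br : 1 <= 2 * pi * beta * r.
  by rewrite -ler_pdivrMl// mulr1 !le_max lexx !orbT.
pose n := (Num.truncn (2 * r / beta)).+1.
have rn : 2 * r < beta * n%:R.
  by rewrite [beta * _]mulrC -ltr_pdivrMr//; exact: truncnS_gt.
exists r, n; split; [exact: br|exact: ltW|].
move=> a.
set A := L `&` `[a, (a + r)%R[%classic.
have cA : ((2 / beta)%:E < counting A * (r^-1)%:E)%E.
  apply: (lt_le_trans bV); apply: (@le_trans _ _ (ereal_inf
    [set (counting (L `&` `[a, (a + r)%R[%classic) * (r^-1)%:E)%E | a in [set: R]])).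
    by apply: ereal_inf_lbound; exists r.
  by apply: ereal_inf_lbound; exists a.
(* An infinite window has infinite counting measure; a finite subset of size at least [n] is taken
   from it. *)
have [B BA nB] : exists2 B : {fset R}, [set` B] `<=` A & (n <= #|` B|)%N.
  have [fA|iA] := pselect (finite_set A); last exact: infinite_set_fset.
  exists (fset_set A); first by move=> y /=; rewrite in_fset_set// => /set_mem.
  move: cA; rewrite /counting asboolT// -EFinM lte_fin ltr_pdivlMr// => cA.
  by rewrite /n truncn_lt_nat ?divr_ge0 ?mulr_ge0 ?(ltW b0) ?(ltW r0)// mulrAC.
exists (take n (enum_fset B)); split.
- exact: size_takel nB.
- by rewrite take_uniq; [|exact: fset_uniq].
- move=> y /mem_take yB; have [Ly] := BA y yB.
  by rewrite /= in_itv.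
Qed.

(** Start at the first lattice point not below [x], which is less than x + s, and take consecutive
    points. *)
Lemma windows_lattice (s r : R) : 0 < s -> 0 <= r ->
  windows [set s * m%:~R | m in [set: int]] r (Num.truncn (r / s)).
Proof.
move=> s0 r0 x; set n := Num.truncn _; pose j := Num.ceil (x / s).
exists [seq s * (j + i%:Z)%:~R | i <- iota 0 n]; split.
- by rewrite size_map size_iota.
- rewrite map_inj_uniq ?iota_uniq// => i k /(mulfI (lt0r_neq0 s0)) /intr_inj /addrI.
  by case.
- move=> _ /mapP[i + ->]; rewrite mem_iota add0n => /andP[_ iN]; split.
    by exists (j + i%:Z).
  have /andP[jx xj] := ceil_itv (x / s).
  rewrite -/j intrD ltr_pdivlMr// in jx; rewrite -/j ler_pdivrMr// in xj.
  have nr : n%:R * s <= r.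
    by rewrite -ler_pdivlMr// truncn_le divr_ge0// ltW.
  have iN' : (i%:R + 1) * s <= n%:R * s by rewrite natr1 ler_pM2r// ler_nat.
  have i0 : 0 <= i%:R * s by rewrite mulr_ge0// ltW.
  by rewrite intrD -pmulrn mulrDr; apply/andP; split; lra.
Qed.

End Main.

Theorem theorem3p9 (R : realType) :
  (forall (beta : R) (Lambda : set R),
     0 < beta -> irrational beta -> countable Lambda ->
     ((2 / beta)%:E < lower_beurling_density Lambda)%E ->
     forall f h : R -> R[i],
       gaussian_SIS beta f -> gaussian_SIS beta h ->
       (forall (x : R) (n : int), Lambda x ->
          `|gabor f x n%:~R| = `|gabor h x n%:~R|) ->
       exists tau : R[i], `|tau| = 1 /\ forall t, f t = tau * h t)
  /\
  (forall eps beta : R,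
     0 < eps -> 0 < beta -> irrational beta ->
     forall f h : R -> R[i],
       gaussian_SIS beta f -> gaussian_SIS beta h ->
       (forall m n : int,
          `|gabor f (beta / (2 + eps) * m%:~R) n%:~R| =
          `|gabor h (beta / (2 + eps) * m%:~R) n%:~R|) ->
       exists tau : R[i], `|tau| = 1 /\ forall t, f t = tau * h t).
Proof.
split=> [beta L b0 ib _ dL f h ff hh fh|eps beta e0 b0 ib f h ff hh fh].
  have [r [n [br rn W]]] := windows_of_density beta L b0 dL.
  exact: gabor_phase b0 ib br rn W ff hh fh.
have pb : 0 < 2 * pi * beta by rewrite !mulr_gt0// pi_gt0.
have e2 : 0 < 2 + eps by rewrite addr_gt0.
have s0 : 0 < beta / (2 + eps) by rewrite divr_gt0.
(* Rounding down the number of lattice points costs at most [beta] in beta n >= r (2 + eps) - beta;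
   r eps >= beta compensates for it. *)
pose r := Num.max (beta / eps) ((2 * pi * beta)^-1).
have re : beta <= r * eps by rewrite -ler_pdivrMr// le_max lexx.
have r0 : 0 <= r by rewrite le_max invr_ge0 (ltW pb) orbT.
apply: (gabor_phase beta r (Num.truncn (r / (beta / (2 + eps))))
  [set beta / (2 + eps) * m%:~R | m in [set: int]] f h b0 ib) => //.
- by rewrite -ler_pdivrMl// mulr1 le_max lexx orbT.
- have := ltW (truncnS_gt (r / (beta / (2 + eps)))).
  rewrite -natr1 -(ler_pM2l b0) (_ : beta * (r / _) = r * (2 + eps)).
    by lra.
  by field; rewrite !gt_eqF.
- exact: windows_lattice.
- by move=> _ n [m _ <-].
Qed.
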